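(* Let $e,n\in\mathbb{Z}_{>0}$ and let $\lambda$ be a partition of $n$. Let $\lambda^{\circ}$ be the $e$-core of $\lambda$ and let $\boldsymbol{\lambda}$ be its $e$-quotient. Let ${\bf s}=(s_1,\ldots,s_e)$ be the multicharge of the $e$-symbol $Y(\lambda)$ of $\lambda$ and let $\tilde{\bf s}=(es_1,es_2+1,\ldots,es_e+(e-1))$. Then $$\tilde{s}_{\lambda}=\pm\,\tilde{s}_{\lambda^{\circ}}\cdot\theta_{e,\tilde{\bf s}}(\tilde{s}_{\boldsymbol{\lambda}}).$$
   Context: $\mathbb{N}=\mathbb{Z}_{\ge0}$; partitions are padded by zeros. A $\beta$-set of charge $m$ is a finite strictly increasing sequence of $m$ elements of $\mathbb{N}$ (identified with a finite set). An $l$-symbol is an $l$-tuple of $\beta$-sets and its multicharge is the tuple of their charges. To a $\beta$-set $(a_1,\ldots,a_m)$ one associates the partition $\Lambda(a_1,\ldots,a_m)=(\lambda_1,\ldots,\lambda_m)$ with $\lambda_i=a_{m-i+1}+i-m$. Core and quotient. For a partition $\lambda$ let $m:=\min\{i>0\mid\lambda_i=0\}$ and $X(\lambda):=\{\lambda_i-i+m\mid 1\le i\le m\}$. The $e$-symbol of $\lambda$ is $Y(\lambda)=(Y_1,\ldots,Y_e)$ with $Y_j=\{k\in\mathbb{N}\mid j-1+ke\in X(\lambda)\}$; let ${\bf s}=(s_1,\ldots,s_e)$ be its multicharge. The $e$-quotient of $\lambda$ is the $e$-partition $\boldsymbol{\lambda}=(\Lambda(Y_1),\ldots,\Lambda(Y_e))$.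 The $e$-core $\lambda^\circ$ is the partition $\Lambda(\{j-1+ke\mid 1\le j\le e,\ 0\le k<s_j\})$. Ariki–Koike algebras. Let $l\in\mathbb{Z}_{>0}$ and let $Q_1,\ldots,Q_l,q$ be indeterminates, $R=\mathbb{Z}[Q_1^{\pm1},\ldots,Q_l^{\pm1},q^{\pm1}]$. The generic Ariki–Koike algebra $\mathcal{H}_n^{\bf q}$ is the associative unital $R$-algebra with generators $T_0,\ldots,T_{n-1}$ and relations $(T_0-Q_1)\cdots(T_0-Q_l)=0$; $(T_i-q)(T_i+1)=0$ for $1\le i\le n-1$; $T_0T_1T_0T_1=T_1T_0T_1T_0$; $T_iT_{i+1}T_i=T_{i+1}T_iT_{i+1}$ for $1\le i\le n-2$; $T_iT_j=T_jT_i$ for $0\le i<j\le n-1$, $j-i>1$. For $l=1$ this is the Hecke algebra of $\mathfrak{S}_n$. Over the fraction field it is split semisimple, with irreducible characters $\chi^{\boldsymbol{\mu}}$ indexed by the $l$-partitions $\boldsymbol{\mu}$ of $n$ (the set of which is denoted $\Pi^l_n$). It carries a canonical symmetrising trace $\tau$ (of Bremke–Malle and Malle–Mathas), and the Schur elements $s_{\boldsymbol{\mu}}\in R$ are defined by $\tau=\sum_{\boldsymbol{\mu}\in\Pi^l_n}\frac{1}{s_{\boldsymbol{\mu}}}\chi^{\boldsymbol{\mu}}$. Put $\tilde{s}_{\boldsymbol{\mu}}:=(q-1)^n s_{\boldsymbol{\mu}}$ for $\boldsymbol{\mu}\in\Pi_n^l$ (and $\tilde s=1$ for the empty multipartition).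 For $\lambda$ and $\lambda^\circ$ one takes $l=1$ (the Schur elements then lie in $\mathbb{Z}[q,q^{-1}]$); for the $e$-quotient $\boldsymbol\lambda$ one takes $l=e$; in each case $n$ is replaced by the size of the (multi)partition. With the labelling of characters used, the following explicit known formula holds. For $\boldsymbol{\mu}=(\mu^1,\ldots,\mu^l)\in\Pi^l_n$ let $m_j:=\min\{i>0\mid\mu^j_i=0\}$, $m:=\max_j m_j$, and let $X=(X_1,\ldots,X_l)$ with $X_j=\{\mu^j_i-i+m\mid 1\le i\le m\}$, $\Gamma_j=\mathbb{N}\setminus X_j$. Let $\mathcal{H}^{CJ}(X)$ be the set of quadruples $(a,b,i,j)$ with $1\le i,j\le l$, $a\in X_i$, $b\in\Gamma_j$ and $\sharp\{\gamma\in\Gamma_i\mid a>\gamma\}>\sharp\{\gamma\in\Gamma_j\mid b>\gamma\}$. Then $$\tilde{s}_{\boldsymbol{\mu}}=(-1)^{n(l-1)}q^{-N(\bar\mu)}\prod_{(a,b,i,j)\in\mathcal{H}^{CJ}(X)}(q^{a-b}Q_iQ_j^{-1}-1),$$ where $\bar\mu$ is the partition of $n$ obtained by reordering all the parts of $\boldsymbol{\mu}$ and $N(\bar\mu)=\sum_{i\ge1}(i-1)\bar\mu_i$. Specialisation. For $k\in\mathbb{Z}_{>0}$ and ${\bf t}=(t_1,\ldots,t_l)\in\mathbb{N}^l$, $\theta_{k,{\bf t}}:R\to\mathbb{Q}(q)$ is the ring homomorphism with $\theta_{k,{\bf t}}(q)=q^k$ and $\theta_{k,{\bf t}}(Q_i)=q^{t_i}$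 for all $i$. *)

(* Defs.v *)
From HB Require Import structures.
From mathcomp Require Import all_boot all_order all_fingroup all_algebra.
From mathcomp Require Import boolp classical_sets fsbigop.
From mathcomp Require Import mpoly.
From mathcomp Require Import zify ring.
Set Implicit Arguments.
Unset Strict Implicit.
Unset Printing Implicit Defensive.
Import GRing.Theory.

(* The indices 1..l and 1..e are shifted to 'I_l and 'I_e, so that the         *)
(* component j : 'I_e of an e-symbol has residue j (not j - 1).                *)

Local Open Scope nat_scope.

(* A partition is the list of its nonzero parts; padding by zeros is nth 0.    *)
Definition is_part (la : seq nat) := sorted geq la && (0 \notin la).

Definition mpart l := {ffun 'I_l -> seq nat}.

Definition msize l (mu : mpart l) := \sum_j sumn (mu j).

Definition is_mpart l n (mu : mpart l) :=
  [forall j, is_part (mu j)] && (msize mu == n).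

Definition part1 (la : seq nat) : mpart 1 := [ffun=> la].

(* A beta-set is a strictly increasing list; its charge is its size.           *)

(* Lambda(a_1 < ... < a_m), with its zero parts removed                        *)
Definition Lambda (a : seq nat) : seq nat :=
  let m := size a in
  [seq p <- [seq nth 0 a (m - i) + i - m | i <- iota 1 m] | 0 < p].

(* min {i > 0 | la_i = 0}                                                      *)
Definition part_rank (la : seq nat) := (find (pred1 0) la).+1.

(* {la_i - i + m | 1 <= i <= m}, listed increasingly                           *)
Definition beta (m : nat) (la : seq nat) : seq nat :=
  rev [seq nth 0 la i.-1 + (m - i) | i <- iota 1 m].

Definition Xset (la : seq nat) := beta (part_rank la) la.

(* For 0 < e, the bound on k is implied by j + k * e \in Xset la.              *)
Definition esymbol e (la : seq nat) (j : 'I_e) : seq nat :=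
  [seq k <- iota 0 (\max_(x <- Xset la) x).+1 | j + k * e \in Xset la].

Definition echarge e (la : seq nat) (j : 'I_e) := size (esymbol la j).

Definition equotient e (la : seq nat) : mpart e :=
  [ffun j => Lambda (esymbol la j)].

Definition ecore e (la : seq nat) : seq nat :=
  Lambda (sort leq
    [seq j + k * e | j : 'I_e <- enum 'I_e, k <- iota 0 (echarge la j)]).

Local Open Scope ring_scope.

(* The variables of {mpoly int[l.+1]} are q (index 0) and Q_1, ..., Q_l.       *)
Definition ratfun l := {fraction {mpoly int[l.+1]}}.
HB.instance Definition _ l := GRing.Field.on (ratfun l).

Definition lfrac l (p : {mpoly int[l.+1]}) (m : 'X_{1..l.+1}) : ratfun l :=
  tofrac p / tofrac 'X_[m].

Definition is_laurent l : {pred ratfun l} :=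
  fun x => `[< exists pm, x = lfrac pm.1 pm.2 >].

Lemma mpolyX_neq0 n (m : 'X_{1..n}) : 'X_[m] != 0 :> {mpoly int[n]}.
Proof.
by apply/eqP => /(congr1 (mcoeff m)) /eqP; rewrite mcoeffX eqxx mcoeff0 oner_eq0.
Qed.

Lemma tofracX_neq0 l (m : 'X_{1..l.+1}) : tofrac 'X_[m] != 0 :> ratfun l.
Proof. by rewrite tofrac_eq0 mpolyX_neq0. Qed.

Lemma lfrac_laurent l p m : lfrac p m \in @is_laurent l.
Proof. by apply/asboolP; exists (p, m). Qed.

Lemma laurentP l (x : ratfun l) :
  reflect (exists pm, x = lfrac pm.1 pm.2) (x \in @is_laurent l).
Proof. exact: asboolP. Qed.

Lemma lfracB l p m p' m' :
  @lfrac l p m - lfrac p' m' = lfrac (p * 'X_[m'] - p' * 'X_[m]) (m + m')%MM.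
Proof.
rewrite /lfrac mpolyXD tofracB !tofracM -mulNr.
by rewrite addf_div ?tofracX_neq0 // mulNr.
Qed.

Lemma lfracM l p m p' m' :
  @lfrac l p m * lfrac p' m' = lfrac (p * p') (m + m')%MM.
Proof. by rewrite /lfrac mpolyXD !tofracM mulf_div. Qed.

Lemma lfrac1 l : @lfrac l 1 0%MM = 1.
Proof. by rewrite /lfrac mpolyX0 tofrac1 divr1. Qed.

Lemma laurent_subring_closed l : subring_closed (@is_laurent l).
Proof.
split=> [|x y /laurentP[[p m] ->] /laurentP[[p' m'] ->]
         |x y /laurentP[[p m] ->] /laurentP[[p' m'] ->]].
- by rewrite -lfrac1 lfrac_laurent.
- by rewrite lfracB lfrac_laurent.
- by rewrite lfracM lfrac_laurent.
Qed.

HB.instance Definition _ l :=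
  GRing.isSubringClosed.Build (ratfun l) (@is_laurent l)
    (@laurent_subring_closed l).

(* Z[q^{+-1}, Q_1^{+-1}, ..., Q_l^{+-1}] inside its fraction field             *)
Record laurent l := Laurent { lval : ratfun l; _ : lval \in @is_laurent l }.
HB.instance Definition _ l := [isSub for @lval l].
HB.instance Definition _ l := [Choice of laurent l by <:].
HB.instance Definition _ l := [SubChoice_isSubComNzRing of laurent l by <:].

Definition mklaurent l p m : laurent l := Laurent (lfrac_laurent p m).

Definition lq l : laurent l := mklaurent 'X_ord0 0%MM.
Definition lqV l : laurent l := mklaurent 1 U_(ord0)%MM.
Definition lQ l (j : 'I_l) : laurent l := mklaurent 'X_(lift ord0 j) 0%MM.

Definition Qq := {fraction {poly rat}}.
HB.instance Definition _ := GRing.Field.on Qq.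
Definition qq : Qq := tofrac 'X.

Section Theta.
Variables (l k : nat) (t : 'I_l -> nat).

Definition theta_var (i : 'I_l.+1) : Qq :=
  if unlift ord0 i is Some j then qq ^+ t j else qq ^+ k.

Definition theta_poly (p : {mpoly int[l.+1]}) : Qq := mmap intr theta_var p.

Lemma laurent_frac (x : laurent l) :
  exists pm, val x == lfrac pm.1 pm.2.
Proof. by case: x => x /= /laurentP[pm ->]; exists pm. Qed.

(* theta_{k,t} : q |-> q^k, Q_j |-> q^{t_j}; see thetaE, theta_q, theta_Q      *)
Definition theta (x : laurent l) : Qq :=
  let pm := xchoose (laurent_frac x) in
  theta_poly pm.1 / theta_poly 'X_[pm.2].

Lemma theta_polyX_neq0 m : theta_poly 'X_[m] != 0.
Proof.
have q0 : qq != 0 by rewrite tofrac_eq0 polyX_eq0.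
rewrite /theta_poly mmapX; apply/prodf_neq0 => i _.
by rewrite /theta_var; case: unlift => [j|]; rewrite !expf_neq0.
Qed.

Lemma theta_polyB : {morph theta_poly : p p' / p - p'}.
Proof. by move=> p p'; rewrite /theta_poly raddfB. Qed.

Lemma theta_polyM : {morph theta_poly : p p' / p * p'}.
Proof. by move=> p p'; rewrite /theta_poly rmorphM. Qed.

Lemma thetaE x p m :
  val x = lfrac p m -> theta x = theta_poly p / theta_poly 'X_[m].
Proof.
rewrite /theta; set pm := xchoose _; move=> xE.
have /eqP : val x == lfrac pm.1 pm.2 := xchooseP (laurent_frac x).
rewrite {}xE /lfrac => /eqP.
rewrite eqr_div ?tofracX_neq0 // -!tofracM tofrac_eq => /eqP pE.
apply/eqP; rewrite eqr_div ?theta_polyX_neq0 //.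
by rewrite -!theta_polyM -pE.
Qed.

Lemma theta_mk p m :
  theta (mklaurent p m) = theta_poly p / theta_poly 'X_[m].
Proof. exact: thetaE. Qed.

Lemma theta_is_zmod_morphism : zmod_morphism theta.
Proof.
move=> x y; case: (laurent_frac x) => -[p m] /eqP /= xE.
case: (laurent_frac y) => -[p' m'] /eqP /= yE.
rewrite (thetaE xE) (thetaE yE).
have /thetaE -> : val (x - y) = lfrac (p * 'X_[m'] - p' * 'X_[m]) (m + m')%MM.
  by rewrite rmorphB /= xE yE lfracB.
rewrite mpolyXD theta_polyB !theta_polyM -[in RHS]mulNr.
by rewrite addf_div ?theta_polyX_neq0 // mulNr.
Qed.

Lemma theta_is_monoid_morphism : monoid_morphism theta.
Proof.
split=> [|x y].
  have /thetaE -> : val (1 : laurent l) = lfrac 1 0%MM by rewrite lfrac1.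
  by rewrite mpolyX0 divff // -mpolyX0 theta_polyX_neq0.
case: (laurent_frac x) => -[p m] /eqP /= xE.
case: (laurent_frac y) => -[p' m'] /eqP /= yE.
rewrite (thetaE xE) (thetaE yE).
have /thetaE -> : val (x * y) = lfrac (p * p') (m + m')%MM.
  by rewrite rmorphM /= xE yE lfracM.
by rewrite mpolyXD !theta_polyM mulf_div.
Qed.

HB.instance Definition _ :=
  GRing.isZmodMorphism.Build (laurent l) Qq theta theta_is_zmod_morphism.
HB.instance Definition _ :=
  GRing.isMonoidMorphism.Build (laurent l) Qq theta theta_is_monoid_morphism.

Lemma theta_q : theta (lq l) = qq ^+ k.
Proof.
rewrite theta_mk /theta_poly !mmapX mmap1U mmap11 divr1.
by rewrite /theta_var unlift_none.
Qed.

Lemma theta_Q j : theta (lQ j) = qq ^+ t j.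
Proof.
rewrite theta_mk /theta_poly !mmapX mmap1U mmap11 divr1.
by rewrite /theta_var liftK.
Qed.

End Theta.

Lemma lqVK l : lq l * lqV l = 1.
Proof.
apply: val_inj; rewrite /= lfracM /lfrac mulr1 add0m divff ?rmorph1 //.
exact: tofracX_neq0.
Qed.

Section Inclusion.
Variable l : nat.

Definition qfrac (p d : {poly int}) : Qq :=
  tofrac (map_poly intr p) / tofrac (map_poly intr d).

Lemma tofrac_map_intr_eq0 (d : {poly int}) :
  (tofrac (map_poly intr d : {poly rat}) == 0) = (d == 0).
Proof.
rewrite tofrac_eq0; apply/eqP/eqP=> [dE|->]; last by rewrite rmorph0.
by apply: (map_inj_poly (f := intr : int -> rat)) => //;
  [exact: intr_inj | rewrite dE rmorph0].
Qed.

Lemma Qq_frac (x : Qq) : exists pd, (pd.2 != 0) && (x == qfrac pd.1 pd.2).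
Proof.
have [p [d [d0 ->]]] : exists p d : {poly rat}, d != 0 /\ x = tofrac p / tofrac d.
  elim/quotW: x => x; exists (\n_x), (\d_x); split; first exact: denom_ratioP.
  apply: (canRL (mulfK _)); first by rewrite tofrac_eq0 denom_ratioP.
  unlock FracField.tofrac; rewrite -[LHS]FracField.pi_mul.
  apply/eqmodP; rewrite /= FracField.equivfE /FracField.mulf.
  by rewrite !numden_Ratio ?mulf_neq0 ?oner_eq0 ?denom_ratioP // !mulr1 mulrC.
have [p' [a a0 pE]] := rat_poly_scale p.
have [d' [b b0 dE]] := rat_poly_scale d.
have ab (c : int) : c != 0 -> c%:~R != 0 :> rat by rewrite intr_eq0.
exists (p' * b%:P, d' * a%:P) => /=.
have d'0 : d' != 0.
  by apply: contra_neq d0 => d'E; rewrite dE d'E map_poly0 scaler0.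
rewrite mulf_neq0 ?polyC_eq0 //= /qfrac.
rewrite eqr_div ?tofrac_eq0 ?d0 //; last first.
  by rewrite -tofrac_eq0 tofrac_map_intr_eq0 mulf_neq0 ?polyC_eq0.
rewrite -!tofracM tofrac_eq pE dE !rmorphM /= !map_polyC /=.
rewrite -!mul_polyC.
have cV (c : int) : c != 0 -> (c%:~R^-1)%:P * c%:~R%:P = 1 :> {poly rat}.
  by move=> c0; rewrite -polyCM mulVf ?ab.
have AC (u v A D : {poly rat}) : u * v = 1 -> u * A * (D * v) = A * D.
  by move=> uv; rewrite -[RHS]mul1r -uv; ring.
by apply/eqP; rewrite AC ?cV // [RHS]mulrC AC ?cV // mulrC.
Qed.

Definition q_eval (p : {poly int}) : ratfun l := (map_poly intr p).[val (lq l)].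

Lemma q_evalE p : q_eval p = tofrac (map_poly intr p).['X_ord0].
Proof.
rewrite /q_eval -horner_map /= -map_poly_comp /=.
rewrite (eq_map_poly (g := intr)); last by move=> c /=; rewrite rmorph_int.
by rewrite /lq /= /lfrac mpolyX0 tofrac1 divr1.
Qed.

Lemma q_eval_neq0 p : p != 0 -> q_eval p != 0.
Proof.
move=> p0; rewrite q_evalE tofrac_eq0; apply: contra_neq p0.
pose f : {mpoly int[l.+1]} -> {poly int} := mmap polyC (fun=> 'X).
move/(congr1 f); rewrite /f rmorph0 -horner_map /= mmapX mmap1U.
rewrite -map_poly_comp (eq_map_poly (g := polyC)) => [|c]; last first.
  by rewrite /= rmorph_int -[in RHS](intz c) rmorph_int.
by rewrite -/(comp_poly _ _) comp_polyXr.
Qed.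

Lemma q_evalB : {morph q_eval : p p' / p - p'}.
Proof. by move=> p p'; rewrite /q_eval rmorphB hornerD hornerN. Qed.

Lemma q_evalM : {morph q_eval : p p' / p * p'}.
Proof. by move=> p p'; rewrite /q_eval rmorphM hornerM. Qed.

(* The inclusion of Q(q) in Q(q, Q_1, ..., Q_l), q |-> q; see qincl_qq         *)
Definition qincl (x : Qq) : ratfun l :=
  let pd := xchoose (Qq_frac x) in q_eval pd.1 / q_eval pd.2.

Lemma qinclE x p d : d != 0 -> x = qfrac p d -> qincl x = q_eval p / q_eval d.
Proof.
rewrite /qincl; set pd := xchoose _ => d0 xE.
have /andP[pd0 /eqP] : (pd.2 != 0) && (x == qfrac pd.1 pd.2)
  := xchooseP (Qq_frac x).
rewrite {}xE /qfrac => /eqP.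
rewrite eqr_div ?tofrac_map_intr_eq0 // -!tofracM tofrac_eq -!rmorphM /=.
move=> /eqP/(map_inj_poly intr_inj (rmorph0 _)) pE.
by apply/eqP; rewrite eqr_div ?q_eval_neq0 // -!q_evalM -pE.
Qed.

Lemma qincl_is_zmod_morphism : zmod_morphism qincl.
Proof.
move=> x y; case: (Qq_frac x) => -[p d] /andP[/= d0 /eqP xE].
case: (Qq_frac y) => -[p' d'] /andP[/= d'0 /eqP yE].
rewrite (qinclE d0 xE) (qinclE d'0 yE).
rewrite (@qinclE (x - y) (p * d' - p' * d) (d * d')) ?mulf_neq0 //.
  rewrite q_evalB !q_evalM -[in RHS]mulNr.
  by rewrite addf_div ?q_eval_neq0 // mulNr.
rewrite xE yE /qfrac !rmorphB !rmorphM /= -[in LHS]mulNr.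
by rewrite addf_div ?tofrac_map_intr_eq0 // mulNr.
Qed.

Lemma qincl_is_monoid_morphism : monoid_morphism qincl.
Proof.
split=> [|x y].
  rewrite (@qinclE 1 1 1) ?oner_neq0 ?divff ?q_eval_neq0 ?oner_neq0 //.
  by rewrite /qfrac divff // tofrac_map_intr_eq0 oner_neq0.
case: (Qq_frac x) => -[p d] /andP[/= d0 /eqP xE].
case: (Qq_frac y) => -[p' d'] /andP[/= d'0 /eqP yE].
rewrite (qinclE d0 xE) (qinclE d'0 yE).
rewrite (@qinclE (x * y) (p * p') (d * d')) ?mulf_neq0 //.
  by rewrite !q_evalM mulf_div.
by rewrite xE yE /qfrac !rmorphM /= mulf_div.
Qed.

HB.instance Definition _ :=
  GRing.isZmodMorphism.Build Qq (ratfun l) qincl qincl_is_zmod_morphism.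
HB.instance Definition _ :=
  GRing.isMonoidMorphism.Build Qq (ratfun l) qincl qincl_is_monoid_morphism.

Lemma qincl_qq : qincl qq = val (lq l).
Proof.
rewrite (@qinclE qq 'X 1) ?oner_neq0 //.
  by rewrite /q_eval map_polyX rmorph1 hornerX hornerC divr1.
by rewrite /qfrac map_polyX rmorph1 tofrac1 divr1.
Qed.

End Inclusion.

Definition AK_relations l n (A : algType (laurent l)) (T : 'I_n -> A) : Prop :=
  [/\ forall i : 'I_n, i = 0%N :> nat -> \prod_(j < l) (T i - (lQ j)%:A) = 0,
      forall i : 'I_n, (0 < i)%N -> (T i - (lq l)%:A) * (T i + 1) = 0,
      forall i j : 'I_n, i = 0%N :> nat -> j = 1%N :> nat ->
        T i * T j * T i * T j = T j * T i * T j * T i,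
      forall i j : 'I_n, (0 < i)%N -> j = i.+1 :> nat ->
        T i * T j * T i = T j * T i * T j
    & forall i j : 'I_n, (i.+1 < j)%N -> T i * T j = T j * T i].

(* (H, T) is presented by these generators and relations; for n = 0 this makes *)
(* H the ground ring.                                                          *)
Definition is_ariki_koike l n (H : algType (laurent l)) (T : 'I_n -> H) : Prop :=
  AK_relations T /\
  forall (B : algType (laurent l)) (S : 'I_n -> B), AK_relations S ->
    exists2 f : {lrmorphism H -> B}, forall i, f (T i) = S i
      & forall g : {lrmorphism H -> B}, (forall i, g (T i) = S i) -> g =1 f.

Definition opred n (i : 'I_n) : 'I_n :=
  Ordinal (leq_ltn_trans (leq_pred i) (ltn_ord i)).

(* The permutation of a word in the simple reflections (i-1, i), 0 < i < n     *)
Definition word_perm n (w : seq 'I_n) : {perm 'I_n} :=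
  (\prod_(i <- w) tperm (opred i) i)%g.

Definition is_word n (w : seq 'I_n) := all (fun i : 'I_n => 0 < i)%N w.

Definition reduced n (w : seq 'I_n) : Prop :=
  is_word w /\ forall w' : seq 'I_n, is_word w' ->
    word_perm w' = word_perm w -> (size w <= size w')%N.

Section Trace.
Variables (l n : nat) (H : algType (laurent l)) (T : 'I_n -> H).

(* Jucys-Murphy element q^{-i} T_i ... T_1 T_0 T_1 ... T_i                     *)
Definition jucys_murphy (i : 'I_n) : H :=
  lqV l ^+ i *: ((\prod_(j <- rev (enum 'I_n) | (j <= i)%N) T j)
                 * \prod_(j < n | (0 < j <= i)%N) T j).

(* The canonical symmetrising trace is given by its values on the              *)
(* Ariki-Koike basis L_1^{c_1} ... L_n^{c_n} T_w, 0 <= c_i < l, w in S_n: it is *)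
(* 1 on the unit and 0 on the other basis elements (Malle-Mathas).             *)
Definition canonical_trace (tau : {scalar H}) : Prop :=
  forall (c : 'I_n -> 'I_l) (w : seq 'I_n), reduced w ->
    tau ((\prod_(i < n) jucys_murphy i ^+ c i) * \prod_(i <- w) T i)
      = ([forall i, c i == 0%N :> nat] && (w == [::]))%:R.

(* phi is the restriction to H of the character of an irreducible              *)
(* representation of ratfun l (x) H, i.e. of an irreducible matrix             *)
(* representation of H over the fraction field of its ground ring.             *)
Definition irr_char (phi : H -> ratfun l) : Prop :=
  exists (d : nat) (rho : {rmorphism H -> 'M[ratfun l]_d.+1}),
    [/\ forall a h, rho (a *: h) = val a *: rho h,
        forall U : 'M[ratfun l]_d.+1,
          (forall h, stablemx U (rho h)) -> U != 0 -> row_full U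
      & forall h, phi h = \tr (rho h)].

Definition irr_labelling (chi : mpart l -> H -> ratfun l) : Prop :=
  [/\ forall mu, is_mpart n mu -> irr_char (chi mu),
      forall mu nu, is_mpart n mu -> is_mpart n nu ->
        chi mu =1 chi nu -> mu = nu
    & forall phi, irr_char phi -> exists2 mu, is_mpart n mu & phi =1 chi mu].

End Trace.

(* s gives the Schur elements of the generic Ariki-Koike algebra for some      *)
(* labelling of its irreducible characters by the l-partitions of n: the last  *)
(* clause reads tau = sum_mu (s mu)^-1 chi^mu.                                 *)
Definition schur_elements l n (s : mpart l -> laurent l) : Prop :=
  exists (H : algType (laurent l)) (T : 'I_n -> H) (tau : {scalar H})
         (chi : mpart l -> H -> ratfun l),
    [/\ is_ariki_koike T, canonical_trace T tau, irr_labelling n chi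
      & (forall mu, is_mpart n mu -> s mu != 0) /\
        forall h, val (tau h) =
          (\sum_(mu \in [set mu | is_mpart n mu]%classic)
             (val (s mu))^-1 * chi mu h)%R].

Definition stilde l (s : mpart l -> laurent l) (mu : mpart l) : laurent l :=
  (lq l - 1) ^+ msize mu * s mu.

Definition gaps (X : seq nat) (a : nat) := count (fun g => g \notin X) (iota 0 a).

Definition mrank l (mu : mpart l) := (\max_j part_rank (mu j))%N.

Definition mbeta l (mu : mpart l) (j : 'I_l) := beta (mrank mu) (mu j).

(* b < a + m is implied by the condition on gaps, see mem_hookCJ.              *)
Definition hookCJ l (mu : mpart l) : seq (nat * nat * 'I_l * 'I_l) :=
  [seq h <- [seq (ab, ij.1, ij.2)
              | ij : 'I_l * 'I_l <- enum {: 'I_l * 'I_l},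
                ab <- [seq (a, b) | a <- mbeta mu ij.1, b <- iota 0 (a + mrank mu)]]
     | (h.1.1.2 \notin mbeta mu h.2)
       && (gaps (mbeta mu h.2) h.1.1.2 < gaps (mbeta mu h.1.2) h.1.1.1)%N].

Lemma size_beta m la : size (beta m la) = m.
Proof. by rewrite size_rev size_map size_iota. Qed.

Lemma beta_uniq m la : is_part la -> uniq (beta m la).
Proof.
case/andP=> la_s _; rewrite rev_uniq map_inj_in_uniq ?iota_uniq //.
have mono i j : (i <= j)%N -> (nth 0 la j <= nth 0 la i)%N.
  move=> ij; case: (ltnP j (size la)) => jl; last by rewrite (nth_default _ jl).
  have geq_trans : transitive geq by move=> y x z xy yz; apply: leq_trans yz xy.
  have := sorted_leq_nth geq_trans leqnn 0%N la_s; apply=> //.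
  exact: leq_ltn_trans ij jl.
have strict i j : (0 < i < j)%N -> (j <= m)%N ->
    (nth 0 la i.-1 + (m - i) = nth 0 la j.-1 + (m - j))%N -> False.
  case/andP=> i0 ij jm.
  have : (nth 0 la j.-1 <= nth 0 la i.-1)%N by apply: mono; lia.
  lia.
move=> i j; rewrite !mem_iota => Hi Hj E.
case: (ltngtP i j) => // ij; exfalso.
  by apply: (strict i j) E; lia.
by apply: (strict j i) (esym E); lia.
Qed.

Lemma gaps_le X a : (gaps X a <= a)%N.
Proof. by rewrite /gaps (leq_trans (count_size _ _)) ?size_iota. Qed.

Lemma le_gaps X b : (b <= gaps X b + size X)%N.
Proof.
rewrite /gaps -[X in (X <= _)%N](size_iota 0 b).
rewrite -(count_predC (fun g => g \notin X)) leq_add2l.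
rewrite -size_filter; apply: uniq_leq_size; first exact/filter_uniq/iota_uniq.
by move=> x; rewrite mem_filter /= negbK => /andP[].
Qed.

Lemma mem_hookCJ l (mu : mpart l) a b i j :
  ((a, b, i, j) \in hookCJ mu) =
    [&& a \in mbeta mu i, b \notin mbeta mu j
      & (gaps (mbeta mu j) b < gaps (mbeta mu i) a)%N].
Proof.
rewrite mem_filter /=; case: (boolP (b \notin _)) => Hb /=; last by rewrite andbF.
case: (ltnP (gaps _ b)) => Hg /=; last by rewrite andbF.
rewrite andbT; apply/allpairsPdep/idP => [[[i' j']] [[a' b']]|Ha].
  case=> _ /allpairsPdep[a2 [b2 [Ha2 _ [-> ->]]]] E.
  by case: E => -> _ -> _.
exists (i, j), (a, b); split=> //; first by rewrite mem_enum.
apply: allpairs_f_dep => //; rewrite mem_iota add0n /=.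
have Hb2 := le_gaps (mbeta mu j) b; rewrite size_beta in Hb2.
apply: leq_ltn_trans Hb2 _.
by rewrite ltn_add2r (leq_trans Hg) // gaps_le.
Qed.

Lemma hookCJ_uniq l (mu : mpart l) n : is_mpart n mu -> uniq (hookCJ mu).
Proof.
case/andP=> /forallP /= Hmu _; apply/filter_uniq/allpairs_uniq_dep.
- exact: enum_uniq.
- move=> [i j] _ /=; apply: allpairs_uniq_dep; last 1 first.
  + by move=> [a b] [a' b'] _ _ /= [-> ->].
  + exact/beta_uniq/Hmu.
  + by move=> a _; apply: iota_uniq.
- by move=> [[i j] [a b]] [[i' j'] [a' b']] _ _ /= [-> -> -> ->].
Qed.

Definition Npart (nu : seq nat) := (\sum_(i < size nu) i * nth 0 nu i)%N.

Definition mbar l (mu : mpart l) : seq nat :=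
  sort geq (flatten [seq mu j | j <- enum 'I_l]).

(* Chlouveraki and Jacon's closed form of stilde. It fixes the labelling of    *)
(* the characters.                                                             *)
Definition CJ_formula l (mu : mpart l) : ratfun l :=
  let q := val (lq l) in
  (-1) ^+ (msize mu * (l - 1)) * q ^- Npart (mbar mu) *
  \prod_(h <- hookCJ mu)
    (q ^ (h.1.1.1%:Z - h.1.1.2%:Z) * val (lQ h.1.2) / val (lQ h.2) - 1).

(* Main.v *)
From mathcomp Require Import all_boot all_order all_algebra.
From mathcomp Require Import mpoly zify ring.
Require Import Defs.

Set Implicit Arguments.
Unset Strict Implicit.
Unset Printing Implicit Defensive.
Import GRing.Theory.
Local Open Scope nat_scope.

(** By the explicit formula, every Schur element in the identity is, up to sign,
    a power of q times a product of factors q^d - 1, one for each generalised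
    hook.  All three can be read off from one e-abacus.

    Let X be a beta-set of the partition, whose elements are called beads; the
    other numbers are holes.  The e-quotient describes the e runners (residue
    classes modulo e) of X separately, and the specialisation
    Q_j = q^(e s_j + j), with q replaced by q^e, is exactly the one that
    restores positions: a quadruple (a, b, i, j) of the quotient becomes a bead
    x on runner i and a hole y on runner j, and its factor becomes
    q^(x - y) - 1.  The condition on the quadruple says that there are more
    holes below x on the runner of x than below y on the runner of y ([hook e]).
    For the partition itself, and for its core, the same description holds with
    a single runner, where the condition is just y < x ([hook 1]).
    [perm_symbol_hooks] is this translation.

    Two statements about an abacus then remain.

    Lengths ([perm_hooks]): the multiset of hook lengths of X is the union of
    that of its core and of the multiset of |x - y| over the e-hooks (x, y)
    of X.  Fix k > 0 and a runner, and compare it with the runner of the numbers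
    smaller by k.  The difference of the numbers of holes below a position is a
    lattice path: its down-steps are the hooks of length k, its steps towards
    zero are the e-hooks with |x - y| = k, and for any path starting at 0 the
    number of steps towards zero is the smaller of the number of up-steps and
    that of down-steps ([walk_min]).  The excess of down-steps over up-steps
    depends only on the numbers of beads on the runners, so it is the same for
    the core, which has no e-hooks.

    Powers of q ([Npart_core]): rewriting q^(-d) - 1 as -q^(-d) (q^d - 1) for
    the e-hooks with x < y produces the power q^(- descent), so
    N(la) = N(core) + e N(quotient) + descent is needed.  The signed sum of
    x - y over the e-hooks is computed in closed form ([sum_hooks]): it is
    e times the sum of min(g(x), g(x')) over all pairs of beads, where g counts
    the holes below on the same runner, plus the change in a sum over beads of a
    quadratic function of the position when the beads are pushed down to the
    core.  As the g(x) are the parts, and zeros, the sum of the minima is 2 N + n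
    ([overlap_symbol]).  Applying this to X and to its core with one runner, and
    to X with e runners, and eliminating the lengths with [perm_hooks], cancels
    the quadratic terms and leaves the wanted relation. *)

(** * Beads and holes on an abacus *)

Definition beads (P : pred nat) n := \sum_(k < n) P k.
Definition holes (P : pred nat) n := \sum_(k < n) ~~ P k.
Definition runner e (X : pred nat) i : pred nat := fun n => X (i + e * n).

(** The abacus only has nonnegative positions; the positions below 0 are thought
    of as beads, so that they contribute no holes. *)
Definition rholes e (X : pred nat) x := holes (runner e X (x %% e)) (x %/ e).
Definition hook e (X : pred nat) x y :=
  [&& X x, ~~ X y & rholes e X y < rholes e X x].

Lemma beadsS P n : beads P n.+1 = beads P n + P n.
Proof. by rewrite /beads big_ord_recr. Qed.

Lemma holesS P n : holes P n.+1 = holes P n + ~~ P n.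
Proof. by rewrite /holes big_ord_recr. Qed.

Lemma beads_holes P n : beads P n + holes P n = n.
Proof.
elim: n => [|n IH]; first by rewrite /beads /holes !big_ord0.
by rewrite beadsS holesS; case: (P n); lia.
Qed.

Lemma leq_holes P m n : m <= n -> holes P m <= holes P n.
Proof.
elim: n => [|n IH]; first by rewrite leqn0 => /eqP->.
rewrite leq_eqVlt => /orP[/eqP->//|/IH le_mn].
by rewrite holesS (leq_trans le_mn) ?leq_addr.
Qed.

Lemma rholesE e X i n : i < e -> rholes e X (i + e * n) = holes (runner e X i) n.
Proof.
move=> ie; rewrite /rholes mulnC addnC modnMDl modn_small //.
by rewrite divnMDl ?divn_small ?addn0 //; lia.
Qed.

(** * Hook lengths of a partition, its core and its quotient *)

(** The path with a down-step at each element of A outside B and an up-step at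
    each element of B outside A has height holes A n - holes B n, hence the left
    side counts its steps towards zero.  Every such step undoes an earlier step
    away from zero, so at any time their number is that of the rarer direction. *)
Lemma walk_min (A B : pred nat) L :
  \sum_(n < L) [&& A n, ~~ B n & holes B n < holes A n]
  + \sum_(n < L) [&& B n, ~~ A n & holes A n < holes B n]
  = minn (\sum_(n < L) (A n && ~~ B n)) (\sum_(n < L) (B n && ~~ A n)).
Proof.
have bal n : holes A n + \sum_(k < n) (A k && ~~ B k)
           = holes B n + \sum_(k < n) (B k && ~~ A k).
  elim: n => [|n IH]; first by rewrite /holes !big_ord0.
  rewrite !holesS !big_ord_recr /=.
  move: (\sum_(k < n) _) (\sum_(k < n) _) IH => a b.
  by case: (A n); case: (B n) => /=; lia.
elim: L => [|L IH]; first by rewrite !big_ord0.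
rewrite !big_ord_recr /=; move: (bal L) IH.
move: (\sum_(n < L) _) (\sum_(n < L) _) (\sum_(n < L) _) (\sum_(n < L) _).
move=> a b c d; case: (A L); case: (B L) => /=; rewrite ?andbF ?addn0 //=;
  by case: ltnP; lia.
Qed.

Section BigClasses.
Variables (R : Type) (idx : R) (op : Monoid.com_law idx).

Lemma big_classes e L (F : nat -> R) :
  \big[op/idx]_(z < e * L) F z
  = \big[op/idx]_(i < e) \big[op/idx]_(n < L) F (i + e * n).
Proof.
elim: L => [|L IH].
  by rewrite muln0 big_ord0 big1 // => i _; exact: big_ord0.
under [RHS]eq_bigr do rewrite big_ord_recr /=.
rewrite big_split /= -IH mulnS addnC big_split_ord /=; congr (op _ _).
by apply: eq_bigr => i _; rewrite addnC.
Qed.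

Lemma big_classes_cond e L (P : pred nat) (F : nat -> R) :
  \big[op/idx]_(z < e * L | P z) F z
  = \big[op/idx]_(i < e) \big[op/idx]_(n < L | P (i + e * n)) F (i + e * n).
Proof.
rewrite big_mkcond /= (big_classes _ _ (fun z => if P z then F z else idx)).
by apply: eq_bigr => i _; rewrite [RHS]big_mkcond.
Qed.

End BigClasses.

(** Moving down by k leads from runner i to runner j and lowers the level by c;
    the bound c <= k tells how high a window must be for comparing the two. *)
Lemma class_shift e i k : i < e ->
  exists c j, [/\ j < e, i + e * c = j + k & c <= k].
Proof.
move=> ie; case: (leqP k i) => ki; first by exists 0, (i - k); split; lia.
pose c := (k - i + e.-1) %/ e.
have H := divn_eq (k - i + e.-1) e.
have H2 : (k - i + e.-1) %% e < e by rewrite ltn_mod; lia.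
rewrite -/c in H; exists c, (i + e * c - k); split; [nia|nia|].
case: (leqP c k) => // kc; nia.
Qed.

(** The positions below k are beads, being the images of negative positions. *)
Definition shifted (X : pred nat) k : pred nat := fun z => (z < k) || X (z - k).

Section Shift.
Variables (e i j c k : nat) (X : pred nat).
Hypotheses (je : j < e) (ijc : i + e * c = j + k).

Lemma runner_shifted n :
  runner e (shifted X k) i n = (n < c) || runner e X j (n - c).
Proof.
rewrite /runner /shifted; case: (ltnP n c) => nc.
  by have -> : i + e * n < k by nia.
have -> : (i + e * n < k) = false by nia.
by congr X; nia.
Qed.

Lemma holes_shifted n :
  holes (runner e (shifted X k) i) n = holes (runner e X j) (n - c).
Proof.
elim: n => [|n IH]; first by rewrite /holes !big_ord0.
rewrite holesS runner_shifted IH; case: ltnP => nc /=.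
  by rewrite addn0; congr holes; lia.
by rewrite subSn // holesS.
Qed.

Lemma beads_shifted n : c <= n ->
  beads (runner e (shifted X k) i) n = c + beads (runner e X j) (n - c).
Proof.
move=> cn; have := beads_holes (runner e (shifted X k) i) n.
by have := beads_holes (runner e X j) (n - c); rewrite holes_shifted; lia.
Qed.

Lemma rholes_shifted n : k <= i + e * n ->
  rholes e X (i + e * n - k) = holes (runner e (shifted X k) i) n.
Proof.
move=> kn; rewrite holes_shifted -rholesE //; congr (rholes _ _ _).
have : c <= n by nia.
by nia.
Qed.
End Shift.

(** The e-hooks (z, z - k) and (z - k, z) with z on runner i are the steps
    towards zero of the path that compares runner i with its shift by k. *)
Lemma hook_pred e i k n (X : pred nat) : i < e ->
  let A := runner e X i in let B := runner e (shifted X k) i in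
  let z := i + e * n in
  ((k <= z) && hook e X z (z - k) = [&& A n, ~~ B n & holes B n < holes A n])
  * ((k <= z) && hook e X (z - k) z = [&& B n, ~~ A n & holes A n < holes B n]).
Proof.
move=> ie A B z; have [c [j [je ijc _]]] := class_shift k ie.
have Bz : B n = (z < k) || X (z - k) by [].
rewrite /hook rholesE // Bz -/(A n); case: (leqP k z) => kz /=; last first.
  rewrite andbF; split=> //.
  have nc : n < c by rewrite /z in kz; nia.
  have -> : holes B n = 0.
    rewrite /B (holes_shifted X je ijc) (_ : n - c = 0); last by lia.
    by rewrite /holes big_ord0.
  by rewrite ltn0 andbF.
by rewrite (rholes_shifted X je ijc kz).
Qed.

Lemma rholes1 X x : rholes 1 X x = holes X x.
Proof.
rewrite /rholes modn1 divn1; apply: eq_bigr => k _.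
by rewrite /runner add0n mul1n.
Qed.

Lemma hook1E X x y : hook 1 X x y = [&& X x, ~~ X y & y < x].
Proof.
rewrite /hook !rholes1; case: (X x) => //=; case: (boolP (X y)) => //= Xy.
case: (ltnP y x) => [yx|xy].
  by have := leq_holes X yx; rewrite holesS Xy addn1.
by rewrite ltnNge leq_holes.
Qed.

Lemma hook_neq e X x : hook e X x x = false.
Proof. by rewrite /hook ltnn !andbF. Qed.

Lemma beads_const (P : pred nat) L n :
  (forall k, P k -> k < L) -> L <= n -> beads P n = beads P L.
Proof.
move=> PL; elim: n => [|n IH]; first by rewrite leqn0 => /eqP->.
rewrite leq_eqVlt => /orP[/eqP->//|Ln]; rewrite beadsS IH //.
by case: (boolP (P n)) => [/PL|_]; lia.
Qed.

Lemma runner_lt e L (X : pred nat) i :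
  i < e -> (forall x, X x -> x < e * L) -> forall n, runner e X i n -> n < L.
Proof. by move=> ie XL n /XL; nia. Qed.

(** From level L on, runners contain only holes; at level 2 L every runner thus
    has at least L holes, as many as there can be below a bead. *)
Lemma rholes_le_runner e L (X : pred nat) x j n :
  (forall x, X x -> x < e * L) -> X x -> j < e -> 2 * L <= n ->
  rholes e X x <= holes (runner e X j) n.
Proof.
move=> XL Xx je Ln; have xL := XL x Xx.
have bound P m : holes P m <= m by rewrite -[leqRHS](beads_holes P); lia.
have e0 : 0 < e by lia.
have := bound (runner e X (x %% e)) (x %/ e); rewrite -/(rholes e X x) => H.
have : x %/ e < L by rewrite ltn_divLR // mulnC.
have := beads_holes (runner e X j) n.
rewrite (beads_const (runner_lt je XL)); last lia.
have := beads_holes (runner e X j) L; lia.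
Qed.

Lemma hook_lt e L (X : pred nat) x y :
  (forall x, X x -> x < e * L) -> hook e X x y ->
  x < 2 * (e * L) /\ y < 2 * (e * L).
Proof.
move=> XL /and3P[Xx Xy lt_yx]; have xL := XL x Xx; split; first lia.
have e0 : 0 < e by lia.
rewrite ltnNge; apply/negP => yL; move: lt_yx; apply/negP; rewrite -leqNgt.
apply: (rholes_le_runner XL) => //; first exact: ltn_pmod.
by rewrite leq_divRL //; lia.
Qed.

(** A list of all e-hooks as soon as the window W is large enough, see [hook_lt]. *)
Definition hooks e X W : seq (nat * nat) :=
  [seq h <- [seq (x, y) | x <- iota 0 W, y <- iota 0 W] | hook e X h.1 h.2].

Lemma mem_hooks e X W x y :
  ((x, y) \in hooks e X W) = [&& hook e X x y, x < W & y < W].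
Proof.
rewrite mem_filter /=; case: hook => //=; apply/allpairsP/andP.
  by case=> -[a b] /= [+ + [-> ->]]; rewrite !mem_iota.
by case=> xW yW; exists (x, y); rewrite !mem_iota.
Qed.

Lemma hooks_uniq e X W : uniq (hooks e X W).
Proof.
apply/filter_uniq/allpairs_uniq; rewrite ?iota_uniq //.
by move=> [a b] [a' b'] _ _ [-> ->].
Qed.

Lemma hooks_window e L (X : pred nat) W W' :
  (forall x, X x -> x < e * L) -> 2 * (e * L) <= W -> 2 * (e * L) <= W' ->
  perm_eq (hooks e X W) (hooks e X W').
Proof.
move=> XL LW LW'; apply: uniq_perm; rewrite ?hooks_uniq // => -[x y].
rewrite !mem_hooks; case: (boolP (hook _ _ _ _)) => //= /(hook_lt XL)[xL yL].
by rewrite !(leq_trans _ LW) ?(leq_trans _ LW').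
Qed.

Lemma big_hooks (R : Type) (idx : R) (op : Monoid.com_law idx) e X W
    (F : nat -> nat -> R) :
  \big[op/idx]_(h <- hooks e X W) F h.1 h.2
  = \big[op/idx]_(x < W) \big[op/idx]_(y < W | hook e X x y) F x y.
Proof.
rewrite big_filter big_mkcond big_allpairs /=.
rewrite -[X in iota 0 X](subn0 W) -/(index_iota 0 W) big_mkord.
by apply: eq_bigr => x _; rewrite big_mkord [RHS]big_mkcond.
Qed.

Definition hook_len x y := (x - y) + (y - x).

Lemma sum_delta W k x (P : pred nat) : x < W ->
  \sum_(y < W) (P y && (x == y + k)) = (k <= x) && P (x - k).
Proof.
move=> xW; case: (leqP k x) => kx /=.
  have lt : x - k < W by lia.
  rewrite (bigD1 (Ordinal lt)) //= subnK // eqxx andbT big1 ?addn0 // => y.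
  by rewrite -val_eqE /= => ne; rewrite (_ : (x == y + k) = false) ?andbF //; lia.
by rewrite big1 // => y _; rewrite (_ : (x == y + k) = false) ?andbF //; lia.
Qed.

Lemma count_hooks e X W k : 0 < k ->
  count_mem k [seq hook_len h.1 h.2 | h <- hooks e X W]
  = \sum_(z < W) ((k <= z) && hook e X z (z - k))
    + \sum_(z < W) ((k <= z) && hook e X (z - k) z).
Proof.
move=> k0; rewrite -sum1_count big_map big_mkcond /=.
rewrite (big_hooks _ e X W (fun x y => if hook_len x y == k then 1 else 0)) /=.
have E (x y : nat) : (if hook e X x y then if hook_len x y == k then 1 else 0 else 0)
   = (hook e X x y && (x == y + k)) + (hook e X x y && (y == x + k)).
  case: hook => //=; rewrite /hook_len; case: eqP; case: eqP; case: eqP; lia.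
under eq_bigr do rewrite big_mkcond /=.
under eq_bigr do (under eq_bigr do rewrite E); rewrite /=.
under eq_bigr do rewrite big_split /=.
rewrite big_split /=; congr (_ + _).
  by apply: eq_bigr => x _; rewrite (sum_delta k (hook e X x)).
rewrite exchange_big /=; apply: eq_bigr => y _.
by rewrite (sum_delta k (fun x => hook e X x y)).
Qed.

Lemma count_hooks0 e X W : count_mem 0 [seq hook_len h.1 h.2 | h <- hooks e X W] = 0.
Proof.
apply/eqP; rewrite -leqn0 leqNgt -has_count; apply/hasP => -[d /mapP[[x y]]].
rewrite mem_hooks => /and3P[h _ _] /= -> /eqP; rewrite /hook_len => xy.
by move: h; rewrite (_ : x = y) ?hook_neq //; lia.
Qed.

(** Down-steps and up-steps of the path comparing runner i with its shift by k. *)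
Definition downs e X k L i :=
  \sum_(n < L) (runner e X i n && ~~ runner e (shifted X k) i n).
Definition ups e X k L i :=
  \sum_(n < L) (runner e (shifted X k) i n && ~~ runner e X i n).

Lemma count_hooks_runners e X L k : 0 < k ->
  count_mem k [seq hook_len h.1 h.2 | h <- hooks e X (e * L)]
  = \sum_(i < e) minn (downs e X k L i) (ups e X k L i).
Proof.
move=> k0; rewrite count_hooks //.
rewrite (big_classes _ e L (fun z => nat_of_bool ((k <= z) && hook e X z (z - k)))).
rewrite (big_classes _ e L (fun z => nat_of_bool ((k <= z) && hook e X (z - k) z))).
rewrite -big_split /=.
apply: eq_bigr => i _; rewrite -walk_min; congr (_ + _);
  by apply: eq_bigr => n _; rewrite (hook_pred k n X (ltn_ord i)).
Qed.

Lemma count_hooks1 e X L k : 0 < k ->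
  count_mem k [seq hook_len h.1 h.2 | h <- hooks 1 X (e * L)]
  = \sum_(i < e) downs e X k L i.
Proof.
move=> k0; rewrite count_hooks // [X in _ + X]big1 ?addn0 => [|z _]; last first.
  by rewrite hook1E (_ : (z < z - k) = false) ?andbF //; lia.
rewrite (big_classes _ e L (fun z => nat_of_bool ((k <= z) && hook 1 X z (z - k)))).
apply: eq_bigr => i _; apply: eq_bigr => n _; congr nat_of_bool.
rewrite hook1E /runner /shifted; case: (leqP k (i + e * n)) => kz /=;
  last by rewrite andbF.
by rewrite (_ : _ - k < _) ?andbT //; lia.
Qed.

(** The excess of down-steps over up-steps only depends on numbers of beads. *)
Lemma downs_ups e X k L i :
  downs e X k L i + beads (runner e (shifted X k) i) L
  = ups e X k L i + beads (runner e X i) L.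
Proof.
rewrite /downs /ups /beads -!big_split /=; apply: eq_bigr => n _.
by case: runner; case: runner.
Qed.

(** C is X with the beads of each runner pushed down. *)
Definition is_core e L (C X : pred nat) :=
  [/\ forall x, X x -> x < e * L, forall x, C x -> x < e * L,
      forall i, i < e -> beads (runner e C i) L = beads (runner e X i) L
    & forall x, C x -> rholes e C x = 0].

Lemma hooks_core e L C X W : is_core e L C X -> hooks e C W = [::].
Proof.
case=> _ _ _ C0; apply/eqP; rewrite -[_ == _]negbK; apply/negP.
rewrite -size_eq0 -lt0n; case E: hooks => [//|[x y] s] _.
have : (x, y) \in hooks e C W by rewrite E mem_head.
by rewrite mem_hooks /hook => /andP[/and3P[/C0-> _]].
Qed.

(** For each length k and runner, down-steps for X exceed the smaller of down- and
    up-steps for X by the excess of down-steps over up-steps, truncated at 0.  This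
    excess is the same for C, where the smaller number is 0 because C has no e-hook,
    so it is the number of hooks of length k of C on this runner. *)
Theorem perm_hooks e L C X W : is_core e L C X -> 2 * (e * L) <= W ->
  perm_eq [seq hook_len h.1 h.2 | h <- hooks 1 X W]
    ([seq hook_len h.1 h.2 | h <- hooks 1 C W]
     ++ [seq hook_len h.1 h.2 | h <- hooks e X W]).
Proof.
move=> CX LW; have [XL CL beadsCX C0] := CX.
apply/permP => a; apply: (permP _ a) => {a}.
apply/allP => /= k _; apply/eqP; rewrite count_cat.
case: (posnP k) => [->|k0]; first by rewrite !count_hooks0.
pose L' := 2 * L + k.
have tr e' L0 (Y : pred nat) : e' * L0 = e * L -> (forall x, Y x -> x < e * L) ->
    count_mem k [seq hook_len h.1 h.2 | h <- hooks e' Y W]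
    = count_mem k [seq hook_len h.1 h.2 | h <- hooks e' Y (e * L')].
  move=> eL YL; apply/permP/perm_map/(hooks_window (L := L0)); rewrite ?eL //.
  by rewrite /L'; nia.
rewrite (tr 1 (e * L)) ?mul1n // (tr 1 (e * L) C) ?mul1n // (tr e L) //.
rewrite !count_hooks1 // count_hooks_runners // -big_split /=.
have := count_hooks_runners e C L' k0; rewrite (hooks_core _ CX) /=.
move=> /esym/eqP; rewrite sum_nat_eq0 => /forallP Cmin.
apply: eq_bigr => i _; have /eqP Ci := Cmin i.
have [c [j [je ijc ck]]] := class_shift k (ltn_ord i).
have := downs_ups e X k L' i; have := downs_ups e C k L' i.
have cL : c <= L' by rewrite /L'; lia.
rewrite !(beads_shifted _ je ijc cL).
have bd (Y : pred nat) (YL : forall x, Y x -> x < e * L) i' n : i' < e -> L <= n ->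
    beads (runner e Y i') n = beads (runner e Y i') L.
  by move=> ie; apply: beads_const; apply: runner_lt.
rewrite !bd ?beadsCX ?ltn_ord //; try (rewrite /L'; lia).
move: Ci; rewrite /minn; move: (downs e X k L' i) (ups e X k L' i) => a b.
move: (downs e C k L' i) (ups e C k L' i) => a' b'.
by case: (ltnP a b); case: (ltnP a' b'); lia.
Qed.

(** * The signed sum of hook lengths *)

(** A bead at level n with h holes below it falls to level n - h. *)
Lemma beads_sum (V : nmodType) (P : pred nat) L (F : nat -> V) :
  (\sum_(n < L | P n) F (n - holes P n)%N = \sum_(p < beads P L) F p)%R.
Proof.
elim: L => [|L IH]; first by rewrite /beads !big_ord0.
rewrite big_mkcond big_ord_recr -big_mkcond /= IH beadsS.
case: (P L); rewrite ?addr0 ?addn0 // addn1 big_ord_recr /=.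
by rewrite -[X in F (X - _)%N](beads_holes P) addnK.
Qed.

Lemma holes_count (P : pred nat) L g :
  \sum_(n < L | ~~ P n && (holes P n < g)) 1 = minn g (holes P L).
Proof.
elim: L => [|L IH]; first by rewrite /holes !big_ord0 minn0.
rewrite big_mkcond big_ord_recr -big_mkcond /= IH holesS.
by case: (P L) => /=; rewrite ?addn0 //; case: ltnP; lia.
Qed.

(** Sum of the levels of the first g holes: the r-th hole, r < g, is at level r plus
    the number of beads below it, and a bead lies below all but min(g, h) of these
    holes, h being the number of holes below the bead. *)
Lemma holes_sum (P : pred nat) L g :
  \sum_(n < L | ~~ P n && (holes P n < g)) n
  + \sum_(n < L | P n) minn g (holes P n)
  = 'C(minn g (holes P L), 2) + minn g (holes P L) * beads P L.
Proof.
elim: L => [|L IH]; first by rewrite /holes /beads !big_ord0 minn0 muln0.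
rewrite big_mkcond big_ord_recr -big_mkcond /=.
rewrite [X in _ + X]big_mkcond big_ord_recr -big_mkcond /=.
rewrite addnACA IH holesS beadsS; have := beads_holes P L.
case: (P L) => /=; first by rewrite addn0; lia.
case: ltnP => hg.
  have -> : minn g (holes P L + 1) = (holes P L).+1 by lia.
  by rewrite binS bin1; lia.
have -> : minn g (holes P L + 1) = g by lia.
by lia.
Qed.

(** Twice the content sum of the row of a bead at position x of a beta-set with m
    elements, up to a term that only depends on the row: the contents of that row run
    through an interval ending at x - m. *)
Definition energy (m x : nat) : int := (x%:Z * x%:Z + x%:Z - m%:Z * x%:Z *+ 2)%R.

Definition overlap e (X : pred nat) W :=
  \sum_(x < W | X x) \sum_(x' < W | X x') minn (rholes e X x) (rholes e X x').

Lemma sum_beads_flush (V : nmodType) e N (X : pred nat) (F : nat -> V) :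
  (\sum_(x < e * N | X x) F (x - e * rholes e X x)%N
   = \sum_(i < e) \sum_(p < beads (runner e X i) N) F (i + e * p)%N)%R.
Proof.
rewrite (big_classes_cond _ e N X (fun x => F (x - e * rholes e X x)%N)).
apply: eq_bigr => i _.
rewrite -(beads_sum (runner e X i) N (fun p => F (i + e * p)%N)).
apply: eq_bigr => n _; rewrite rholesE //; congr F.
by have := beads_holes (runner e X i) n; nia.
Qed.

Lemma rholes_mul_le e X x : e * rholes e X x <= x.
Proof.
rewrite [leqRHS](divn_eq x e) mulnC (leq_trans _ (leq_addr _ _)) // leq_mul2r.
by rewrite /rholes -[leqRHS](beads_holes (runner e X (x %% e))) leq_addl orbT.
Qed.

Section HookSums.
Variables (e L N : nat) (X : pred nat).
Hypotheses (XL : forall x, X x -> x < e * L) (LN : 2 * L <= N).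
Local Notation s i := (beads (runner e X i) N).

Let big_holes (R : Type) (idx : R) op g (F : nat -> nat -> R) (i : 'I_e) :
  \big[op/idx]_(n < N | ~~ X (i + e * n) && (rholes e X (i + e * n) < g)) F i n
  = \big[op/idx]_(n < N | ~~ runner e X i n && (holes (runner e X i) n < g))
      F i n.
Proof. by apply: eq_bigl => n; rewrite rholesE. Qed.

Lemma card_hooks_from x : X x ->
  \sum_(y < e * N | hook e X x y) 1 = e * rholes e X x.
Proof.
move=> Xx; rewrite /hook Xx /=.
rewrite (big_classes_cond _ e N
  (fun y => ~~ X y && (rholes e X y < rholes e X x)) (fun _ => 1)).
rewrite (eq_bigr (fun _ => rholes e X x)) => [|i _].
  by rewrite sum_nat_const card_ord.
rewrite (big_holes _ _ _ (fun _ _ => 1)) holes_count.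
by apply/minn_idPl/(rholes_le_runner XL).
Qed.

Lemma sum_hooks_from x : X x -> let g := rholes e X x in
  \sum_(y < e * N | hook e X x y) y
  + e * \sum_(x' < e * N | X x') minn g (rholes e X x')
  = g * \sum_(i < e) (i + e * s i) + e * e * 'C(g, 2).
Proof.
move=> Xx g; rewrite /hook Xx /=.
rewrite (big_classes_cond _ e N (fun y => ~~ X y && (rholes e X y < g)) id).
rewrite (big_classes_cond _ e N X (fun x' => minn g (rholes e X x'))).
rewrite big_distrr -big_split /= big_distrr /=.
have -> : e * e * 'C(g, 2) = \sum_(i < e) e * 'C(g, 2).
  by rewrite sum_nat_const card_ord mulnA.
rewrite -big_split /=; apply: eq_bigr => i _.
rewrite (big_holes _ _ _ (fun i n => i + e * n)) big_split /= -big_distrr /=.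
under [X in _ + e * X]eq_bigr do rewrite rholesE //.
have gi : minn g (holes (runner e X i) N) = g.
  by apply/minn_idPl/(rholes_le_runner XL).
have := holes_sum (runner e X i) N g; rewrite gi => H.
have := holes_count (runner e X i) N g; rewrite gi => C.
rewrite -[X in X + _ + _](_ : i * \sum_(n < N | ~~ runner e X i n
    && (holes (runner e X i) n < g)) 1 = _); last first.
  by rewrite big_distrr /=; apply: eq_bigr => n _; rewrite muln1.
rewrite C -addnA -mulnDr; move: (\sum_(n < N | _) n + _) H => a ->.
by rewrite !mulnDr -addnA mulnC (addnC (e * _)) mulnCA.
Qed.

(** Both sides are sums over the beads x.  With g holes below x on its runner, x
    forms e-hooks with the first g holes of every runner, whose positions are summed
    by [sum_hooks_from]; x itself falls to x - e g in the core.  The terms that are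
    not minima then combine into energy x - energy (x - e g). *)
Lemma sum_hooks : let m := \sum_(i < e) s i in
  (2%:Z * \sum_(h <- hooks e X (e * N)) (h.1%:Z - h.2%:Z)
   = (2 * e * overlap e X (e * N))%:Z
     + (\sum_(x < e * N | X x) energy m x
        - \sum_(i < e) \sum_(p < s i) energy m (i + e * p)%N))%R.
Proof.
have Posz_sum (I : Type) (r : seq I) (P : pred I) (F : I -> nat) :
    Posz (\sum_(i <- r | P i) F i) = (\sum_(i <- r | P i) (F i)%:Z)%R.
  by move=> *; exact: (big_morph Posz PoszD (erefl _)).
move=> m; rewrite -sum_beads_flush -sumrB.
rewrite (big_hooks _ e X _ (fun x y => x%:Z - y%:Z)%R) /=.
rewrite /overlap -mulnA !PoszM Posz_sum !mulr_sumr -big_split [RHS]big_mkcond /=.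
apply: eq_bigr => x _.
case: ifPn => [Xx|/negPf X0]; last first.
  by rewrite big_pred0 ?mulr0 // => y; rewrite /hook X0.
rewrite sumrB -!Posz_sum.
have -> : \sum_(y < e * N | hook e X x y) x = x * (e * rholes e X x).
  by rewrite -card_hooks_from // big_distrr /=; under [RHS]eq_bigr do rewrite muln1.
have := sum_hooks_from Xx; have := rholes_mul_le e X x.
have bin2E n : 2 * 'C(n, 2) + n = n * n.
  by rewrite -mul_bin_diag bin1; case: n => // n; lia.
have -> : \sum_(i < e) (i + e * s i) = 'C(e, 2) + e * m.
  by rewrite big_split /= -big_distrr -(big_mkord xpredT id) bin2_sum.
have := bin2E e; have := bin2E (rholes e X x).
rewrite /energy; move: (rholes e X x) => g.
move: (\sum_(x' < e * N | X x') _) (\sum_(y < e * N | _) _) => a b.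
move: 'C(g, 2) 'C(e, 2) (nat_of_ord x) => cg ce {Xx}x Hg He gx H.
have -> : Posz (x - e * g) = (x%:Z - e%:Z * g%:Z)%R by rewrite -subzn ?PoszM.
have {}H : (b%:Z = g%:Z * (ce%:Z + e%:Z * m%:Z) + e%:Z * e%:Z * cg%:Z
                   - e%:Z * a%:Z)%R by lia.
have {}Hg : (cg%:Z *+ 2 = g%:Z * g%:Z - g%:Z)%R by lia.
have {}He : (ce%:Z *+ 2 = e%:Z * e%:Z - e%:Z)%R by lia.
rewrite H !PoszM.
transitivity (2%:Z * (x%:Z * (e%:Z * g%:Z)) - g%:Z * (ce%:Z *+ 2)
   - 2%:Z * g%:Z * e%:Z * m%:Z - e%:Z * e%:Z * (cg%:Z *+ 2) + 2%:Z * e%:Z * a%:Z)%R;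
  first by ring.
by rewrite Hg He; ring.
Qed.
End HookSums.

(** * Comparing an abacus with its core *)

Lemma is_core_beads e L N C X i : is_core e L C X -> L <= N -> i < e ->
  beads (runner e C i) N = beads (runner e X i) N.
Proof.
case=> XL CL CX _ LN ie.
by rewrite !(beads_const (runner_lt ie _) LN) ?CX.
Qed.

Lemma beads_runners e X N : beads X (e * N) = \sum_(i < e) beads (runner e X i) N.
Proof. exact: (big_classes _ e N (fun z => nat_of_bool (X z))). Qed.

Lemma beads_runner1 X i n : i < 1 -> beads (runner 1 X i) n = beads X n.
Proof.
by case: i => // _; apply: eq_bigr => k _; rewrite /runner add0n mul1n.
Qed.

(** Truncated subtraction: only the e-hooks (x, y) with x < y contribute. *)
Definition descent e X W := \sum_(h <- hooks e X W) (h.2 - h.1).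

Lemma sum_hooks_dist e X W :
  (\sum_(h <- hooks e X W) (h.1%:Z - h.2%:Z)
   = (\sum_(h <- hooks e X W) hook_len h.1 h.2)%N%:Z - (2 * descent e X W)%N%:Z)%R.
Proof.
rewrite /descent big_distrr /= !(big_morph Posz PoszD (erefl _)) -sumrB.
by apply: eq_bigr => h _; rewrite /hook_len; lia.
Qed.

Lemma descent1 X W : descent 1 X W = 0.
Proof.
rewrite /descent (big_hooks _ 1 X W (fun x y => y - x)) big1 // => x _.
by rewrite big1 // => y; rewrite hook1E => /and3P[_ _ yx]; lia.
Qed.

Lemma size_hooks e L N (X : pred nat) :
  (forall x, X x -> x < e * L) -> 2 * L <= N ->
  size (hooks e X (e * N)) = e * \sum_(x < e * N | X x) rholes e X x.
Proof.
move=> XL LN; rewrite -sum1_size (big_hooks _ e X _ (fun _ _ => 1)) big_distrr.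
rewrite [RHS]big_mkcond; apply: eq_bigr => x _ /=; case: ifPn => [Xx|/negPf X0].
  exact: card_hooks_from XL LN x Xx.
by rewrite big_pred0 // => y; rewrite /hook X0.
Qed.

Section Core.
Variables (e L N : nat) (C X : pred nat).
Hypotheses (CX : is_core e L C X) (LN : 2 * L <= N).
Let W := e * N.
Local Notation m := (\sum_(i < e) beads (runner e X i) N).

Lemma sum_hooks1 (Y : pred nat) : (forall x, Y x -> x < e * L) ->
  (forall i, i < e -> beads (runner e Y i) N = beads (runner e X i) N) ->
  (2%:Z * \sum_(h <- hooks 1 Y W) (h.1%:Z - h.2%:Z)
   = (2 * overlap 1 Y W)%N%:Z
     + (\sum_(x < W | Y x) energy m x - \sum_(p < m) energy m p))%R.
Proof.
move=> YL YX; have YL1 x : Y x -> x < 1 * (e * L) by rewrite mul1n; apply: YL.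
have := @sum_hooks 1 (e * L) (e * N) Y YL1; rewrite -/W !mul1n muln1 => ->; last first.
  by rewrite /W mulnCA leq_mul2l LN orbT.
rewrite !big_ord1 beads_runner1 // /W beads_runners.
rewrite (eq_bigr (fun i : 'I_e => beads (runner e X i) N)) => [|i _]; last exact: YX.
congr (_ + (_ - _))%R; apply: eq_bigr => p _; by rewrite add0n mul1n.
Qed.

Lemma sum_hooks_core_energy :
  (2%:Z * \sum_(h <- hooks e X W) (h.1%:Z - h.2%:Z)
   = (2 * e * overlap e X W)%N%:Z
     + (\sum_(x < W | X x) energy m x - \sum_(x < W | C x) energy m x))%R.
Proof.
have [XL CL _ C0] := CX; rewrite (sum_hooks XL LN); congr (_ + (_ - _))%R.
transitivity (\sum_(x < W | C x) energy m (x - e * rholes e C x)%N)%R.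
  rewrite (sum_beads_flush e N C (energy m)); apply: eq_bigr => i _.
  by rewrite (is_core_beads CX) //; lia.
by apply: eq_bigr => x Cx; rewrite C0 // muln0 subn0.
Qed.

(** Three instances of [sum_hooks] (X and C with one runner, X with e runners) and
    the additivity of lengths from [perm_hooks]: the energies cancel. *)
Theorem overlap_core :
  overlap 1 X W = overlap 1 C W + e * overlap e X W + 2 * descent e X W.
Proof.
have [XL CL _ _] := CX.
have W2 : 2 * (e * L) <= W by rewrite /W; nia.
have /perm_sumn := perm_hooks CX W2.
rewrite sumn_cat !sumnE !big_map => D.
have := sum_hooks1 XL (fun _ _ => erefl).
have LN1 : L <= N by rewrite (leq_trans _ LN) // leq_pmull.
have := sum_hooks1 CL (fun i ie => is_core_beads CX LN1 ie).
have := sum_hooks_core_energy.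
rewrite !sum_hooks_dist !descent1 -mulnA.
move: (overlap _ _ _) (overlap _ _ _) (overlap _ _ _) (descent _ _ _) => a b c d.
move: (\sum_(x < W | X x) _)%R (\sum_(x < W | C x) _)%R (\sum_(p < m) _)%R => u v w.
move: D; move: (\sum_(h <- _) _) (\sum_(h <- _) _) (\sum_(h <- _) _) => p q r.
lia.
Qed.

Theorem size_core :
  \sum_(x < W | X x) rholes 1 X x
  = \sum_(x < W | C x) rholes 1 C x + e * \sum_(x < W | X x) rholes e X x.
Proof.
have [XL CL _ _] := CX.
have W2 : 2 * (e * L) <= W by rewrite /W; nia.
have /perm_size := perm_hooks CX W2.
have sz1 (Y : pred nat) : (forall x, Y x -> x < e * L) ->
    size (hooks 1 Y W) = \sum_(x < W | Y x) rholes 1 Y x.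
  move=> YL; have := @size_hooks 1 (e * L) W Y; rewrite !mul1n; apply => //.
by rewrite size_cat !size_map !sz1 // (size_hooks XL LN).
Qed.
End Core.

(** * Beta-sets, partitions and the map Lambda *)

Lemma gapsE A a : gaps A a = holes (mem A) a.
Proof.
rewrite /gaps /holes -sum1_count big_mkcond /= -[X in iota 0 X](subn0 a).
by rewrite -/(index_iota 0 a) big_mkord; apply: eq_bigr => k _ /=; case: (_ \in _).
Qed.

Lemma big_window (R : Type) (idx : R) (op : Monoid.com_law idx) A W (F : nat -> R) :
  uniq A ->
  \big[op/idx]_(k < W | val k \in A) F k = \big[op/idx]_(x <- A | x < W) F x.
Proof.
move=> uA; rewrite -(big_mkord (mem A) F) /index_iota subn0 -!(big_filter _ (mem A)).
rewrite -[RHS]big_filter; apply/perm_big/uniq_perm.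
- exact/filter_uniq/iota_uniq.
- exact: filter_uniq.
by move=> x; rewrite !mem_filter mem_iota /= andbC.
Qed.

Lemma beads_mem A W : uniq A -> beads (mem A) W = \sum_(x <- A | x < W) 1.
Proof.
move=> uA; rewrite -(big_window _ W (fun _ => 1) uA) /beads [RHS]big_mkcond.
by apply: eq_bigr => k _ /=; case: (_ \in _).
Qed.

Lemma mem_betaP m la z :
  reflect (exists2 i, i < m & z = nth 0 la i + (m - i.+1)) (z \in beta m la).
Proof.
rewrite mem_rev; apply: (iffP mapP) => [[i]|[i im ->]].
  by rewrite mem_iota => i1 ->; exists i.-1; [lia|congr (_ + _); lia].
by exists i.+1 => //; rewrite mem_iota; lia.
Qed.

Lemma big_beta (R : Type) (idx : R) (op : Monoid.com_law idx) m la (F : nat -> R) :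
  \big[op/idx]_(x <- beta m la) F x
  = \big[op/idx]_(i < m) F (nth 0 la i + (m - i.+1)).
Proof.
rewrite (perm_big _ (permEl (perm_rev _))) big_map.
rewrite -[X in iota 1 X](subn1 m.+1) -/(index_iota 1 m.+1).
by rewrite big_add1 big_mkord.
Qed.

Lemma mem_beta_shift m c la z : size la <= m ->
  (z \in beta (m + c) la) = (z < c) || (z - c \in beta m la).
Proof.
move=> lam; case: (ltnP z c) => zc /=.
  by apply/mem_betaP; exists (m + (c - z.+1)); rewrite ?nth_default //; lia.
apply/mem_betaP/mem_betaP => -[i im zE]; exists i; try lia.
  by rewrite ltnNge; apply/negP => mi; move: zE; rewrite nth_default; lia.
suff : i < m by lia.
by rewrite ltnNge; apply/negP => mi; move: zE; rewrite nth_default; lia.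
Qed.

Lemma holes_beta_shift m c la a : size la <= m ->
  holes (mem (beta (m + c) la)) (a + c) = holes (mem (beta m la)) a.
Proof.
move=> lam; elim: a => [|a IH].
  rewrite add0n /holes big_ord0 big1 // => k _ /=.
  by rewrite mem_beta_shift // ltn_ord.
rewrite addSn !holesS IH /= mem_beta_shift //.
by rewrite addnK (_ : (a + c < c) = false) //; lia.
Qed.

Lemma geq_trans : transitive geq.
Proof. by move=> y x z xy yz; apply: leq_trans yz xy. Qed.

Lemma nth_part_le la i j : is_part la -> i <= j -> nth 0 la j <= nth 0 la i.
Proof.
case/andP=> la_s _ ij; case: (ltnP j (size la)) => jl;
  last by rewrite (nth_default _ jl).
apply: (sorted_leq_nth geq_trans leqnn 0 la_s) => //.
exact: leq_ltn_trans ij jl.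
Qed.

(** The holes below the bead of a row are as many as the boxes of the row. *)
Lemma holes_beta m la i : is_part la -> i < m ->
  holes (mem (beta m la)) (nth 0 la i + (m - i.+1)) = nth 0 la i.
Proof.
move=> pla im; set a := _ + _.
suff : beads (mem (beta m la)) a = m - i.+1.
  by have := beads_holes (mem (beta m la)) a; rewrite /a; lia.
rewrite beads_mem ?beta_uniq // big_mkcond.
rewrite (big_beta _ m la (fun x => if x < a then 1 else 0)).
transitivity (\sum_(j < m) (i < j)).
  apply: eq_bigr => j _; rewrite /a; case: (ltnP i j) => ij.
    have := nth_part_le pla (ltnW ij); have := ltn_ord j.
    by case: (ltnP (_ + _)) => //; lia.
  by have := nth_part_le pla ij; case: (ltnP (_ + _)) => //; lia.
elim: m im {a} => // m IH; rewrite ltnS leq_eqVlt big_ord_recr /= => /orP[/eqP<-|im].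
  by rewrite ltnn subnn addn0 big1 // => j _; rewrite ltnNge ltnW.
by rewrite IH // im; lia.
Qed.

Lemma sum_holes_beta m la (h : nat -> nat) : is_part la -> size la <= m -> h 0 = 0 ->
  \sum_(x <- beta m la) h (holes (mem (beta m la)) x) = \sum_(p <- la) h p.
Proof.
move=> pla lam h0; rewrite (big_beta _ m la (fun x => h (holes _ x))) /=.
under eq_bigr do rewrite holes_beta //.
rewrite (big_nth 0) big_mkord (big_ord_widen m (fun i => h (nth 0 la i)) lam).
rewrite [RHS]big_mkcond; apply: eq_bigr => i _.
by case: ltnP => // li; rewrite nth_default.
Qed.

(** In a weakly decreasing list the zeros are at the end, and 0 is also the default
    value of nth. *)
Lemma nth_filter_pos l i : sorted geq l -> nth 0 [seq p <- l | 0 < p] i = nth 0 l i.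
Proof.
elim: l i => // p l IH i /= pl; have sl := path_sorted pl.
case: (posnP p) => [p0|p_gt0]; last by case: i => //= i; apply: IH.
have /all_pred1P l0 : all (pred1 0) l.
  by apply: sub_all (order_path_min geq_trans pl) => x /=; rewrite p0 leqn0.
by rewrite l0 p0 -[0 :: _]/(nseq (size l).+1 0) nth_nseq if_same filter_nseq /= nth_nil.
Qed.

Section LambdaLemmas.
Variable A : seq nat.
Hypothesis sA : sorted ltn A.
Local Notation s := (size A).
Let raw := [seq nth 0 A (s - i) + i - s | i <- iota 1 s].

Lemma nth_sorted_ltn i j : i < j -> j < s -> nth 0 A i < nth 0 A j.
Proof.
by move=> ij js; apply: (sorted_ltn_nth ltn_trans) => //; apply: ltn_trans js.
Qed.

Lemma leq_nth_sorted i : i < s -> i <= nth 0 A i.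
Proof.
elim: i => // i IH iA; apply: leq_ltn_trans (IH (ltnW iA)) _.
exact: nth_sorted_ltn.
Qed.

Let nth_raw i : i < s -> nth 0 raw i = nth 0 A (s - i.+1) - (s - i.+1).
Proof.
move=> iA; rewrite (nth_map 0) ?size_iota // nth_iota // add1n; lia.
Qed.

Let raw_sorted : sorted geq raw.
Proof.
apply/(sortedP 0) => i; rewrite size_map size_iota => iA /=.
rewrite !nth_raw //; last exact: ltnW.
have := @nth_sorted_ltn (s - i.+2) (s - i.+1); lia.
Qed.

Lemma Lambda_part : is_part (Lambda A).
Proof.
rewrite /is_part /Lambda; apply/andP; split; last by rewrite mem_filter.
exact: (sorted_filter geq_trans).
Qed.

Lemma size_Lambda : size (Lambda A) <= s.
Proof. by rewrite size_filter (leq_trans (count_size _ _)) // size_map size_iota. Qed.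

Lemma mem_beta_Lambda : beta s (Lambda A) =i A.
Proof.
have E i : i < s -> nth 0 (Lambda A) i + (s - i.+1) = nth 0 A (s - i.+1).
  move=> iA; rewrite nth_filter_pos // nth_raw //.
  by rewrite subnK // leq_nth_sorted //; lia.
move=> z; apply/mem_betaP/(nthP 0) => [[i iA ->]|[k kA <-]].
  by exists (s - i.+1); rewrite ?E // ltn_subrL (leq_ltn_trans _ iA).
have ks : s - k.+1 < s by rewrite ltn_subrL (leq_ltn_trans _ kA).
by exists (s - k.+1); rewrite ?E // subnSK // subKn // ltnW.
Qed.

Lemma mem_beta_Lambda_shift c z :
  (z \in beta (s + c) (Lambda A)) = (z < c) || (z - c \in A).
Proof. by rewrite mem_beta_shift ?size_Lambda // mem_beta_Lambda. Qed.
End LambdaLemmas.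

(** The part with index i is the minimum of the pair formed with each of the i
    earlier parts; these pairs occur twice, and the diagonal adds the size. *)
Lemma Npart_min nu : sorted geq nu ->
  2 * Npart nu + sumn nu = \sum_(p <- nu) \sum_(p' <- nu) minn p p'.
Proof.
elim: nu => [|p nu IH] /= snu; first by rewrite /Npart big_ord0 big_nil.
have /allP pmax := order_path_min geq_trans snu.
have -> : Npart (p :: nu) = Npart nu + sumn nu.
  rewrite /Npart /= big_ord_recl mul0n add0n sumnE (big_nth 0) big_mkord -big_split.
  by apply: eq_bigr => i _; rewrite /= /bump mulSn addnC.
have sum_p : \sum_(p' <- nu) minn p p' = sumn nu.
  rewrite sumnE big_seq [RHS]big_seq; apply: eq_bigr => p' /pmax /= pp'.
  exact/minn_idPr.
under eq_bigr do rewrite big_cons.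
rewrite big_cons big_split /= -(IH (path_sorted snu)) sum_p minnn.
under eq_bigr do rewrite minnC.
by rewrite sum_p; lia.
Qed.

Lemma Npart_mbar l (mu : mpart l) :
  2 * Npart (mbar mu) + msize mu
  = \sum_(p <- mbar mu) \sum_(p' <- mbar mu) minn p p'.
Proof.
have geq_total : total geq by move=> x y; apply: leq_total.
rewrite -Npart_min ?sort_sorted //; congr (_ + _).
rewrite /mbar (perm_sumn (permEl (perm_sort _ _))) sumn_flatten sumnE.
by rewrite 2!big_map big_enum.
Qed.

Lemma big_mbar (R : Type) (idx : R) (op : Monoid.com_law idx) l (mu : mpart l) F :
  \big[op/idx]_(p <- mbar mu) F p = \big[op/idx]_j \big[op/idx]_(p <- mu j) F p.
Proof.
by rewrite (perm_big _ (permEl (perm_sort _ _))) big_flatten big_map big_enum.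
Qed.

(** * Symbols as abaci *)

Lemma size_part_rank la : is_part la -> part_rank la = (size la).+1.
Proof.
case/andP=> _ la0; congr _.+1; apply/eqP; rewrite eqn_leq find_size /=.
by rewrite leqNgt -has_find has_pred1.
Qed.

Lemma size_mrank l (mu : mpart l) j : is_part (mu j) -> size (mu j) <= mrank mu.
Proof.
move=> pj; apply: leq_trans (leq_bigmax j).
by rewrite size_part_rank.
Qed.

Section SymbolHooks.
Variables (l L : nat) (mu : mpart l) (c : 'I_l -> nat) (X : pred nat).
Hypotheses (pmu : forall j, is_part (mu j))
  (cM : forall j, mrank mu <= c j)
  (XE : forall (j : 'I_l) n, runner l X j n = (n \in beta (c j) (mu j)))
  (XL : forall x, X x -> x < l * L).

(** Runner j holds a beta-set of size c j, which is the one of common size mrank mu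
    moved up by c j - mrank mu. *)
Definition symbol_pos (j : 'I_l) a := j + l * (a + (c j - mrank mu)).

Definition symbol_hook (h : nat * nat * 'I_l * 'I_l) :=
  (symbol_pos h.1.2 h.1.1.1, symbol_pos h.2 h.1.1.2).

Let cE (j : 'I_l) : c j = mrank mu + (c j - mrank mu). Proof. by rewrite subnKC. Qed.

Let lam (j : 'I_l) : size (mu j) <= mrank mu. Proof. exact: size_mrank. Qed.

Lemma mem_symbol_pos j a : X (symbol_pos j a) = (a \in mbeta mu j).
Proof.
rewrite -[X _]/(runner l X j _) XE.
have := mem_beta_shift (c j - mrank mu) (a + (c j - mrank mu)) (lam j).
by rewrite -cE addnK ltnNge leq_addl.
Qed.

Let holes_runner (j : 'I_l) n :
  holes (runner l X j) n = holes (mem (beta (c j) (mu j))) n.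
Proof. by apply: eq_bigr => k _; rewrite XE. Qed.

Lemma rholes_symbol_pos j a : rholes l X (symbol_pos j a) = gaps (mbeta mu j) a.
Proof.
rewrite /symbol_pos rholesE // holes_runner gapsE.
by have := holes_beta_shift (c j - mrank mu) a (lam j); rewrite -cE.
Qed.

(** The positions outside the image carry beads with no hole below them on their
    runner, so no hook involves them. *)
Lemma symbol_pos_onto x : 0 < rholes l X x \/ ~~ X x ->
  0 < l -> exists j a, x = symbol_pos j a.
Proof.
move=> hx l0; pose j := Ordinal (ltn_pmod x l0); pose d := c j - mrank mu.
have xE : x = j + l * (x %/ l) by rewrite {1}(divn_eq x l) addnC mulnC.
suff dx : d <= x %/ l by exists j, (x %/ l - d); rewrite /symbol_pos subnK.
have in_beta n : n < d -> runner l X j n.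
  by move=> nd; have := mem_beta_shift d n (lam j); rewrite -cE nd XE.
rewrite leqNgt; apply/negP => xd; case: hx.
  by rewrite {1}xE rholesE // /holes big1 // => k _;
    rewrite in_beta // (ltn_trans _ xd).
by rewrite {1}xE => /negP; apply; apply: in_beta.
Qed.

Lemma symbol_pos_inj i j a b : symbol_pos i a = symbol_pos j b -> i = j /\ a = b.
Proof.
rewrite /symbol_pos => E.
have ij : i = j.
  apply: val_inj; move/(congr1 (modn^~ l)): E.
  by rewrite !(mulnC l) !(addnC (nat_of_ord _)) !modnMDl !modn_small.
split=> //; move: E; rewrite ij => /addnI/eqP.
rewrite eqn_mul2l => /orP[/eqP l0|/eqP/addIn//].
by have := leq_ltn_trans (leq0n j) (ltn_ord j); rewrite l0.
Qed.

Lemma perm_symbol_hooks W : 2 * (l * L) <= W ->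
  perm_eq [seq symbol_hook h | h <- hookCJ mu] (hooks l X W).
Proof.
move=> LW; apply: uniq_perm; last 1 first.
- move=> [x y]; rewrite mem_hooks; apply/mapP/idP.
    case=> -[[[a b] i] j]; rewrite mem_hookCJ => /and3P[Ha Hb lt_ba] [-> ->] /=.
    have Hh : hook l X (symbol_pos i a) (symbol_pos j b).
      by rewrite /hook !mem_symbol_pos !rholes_symbol_pos Ha Hb.
    by rewrite Hh; have [] := hook_lt XL Hh; move=> *; apply/andP; split; lia.
  case/and3P => /[dup] Hh /and3P[Xx Xy lt_yx] _ _.
  have l0 : 0 < l by have := XL Xx; case: (l).
  have [|//|i [a xE]] := @symbol_pos_onto x; first by left; apply: leq_ltn_trans lt_yx.
  have [|//|j [b yE]] := @symbol_pos_onto y; first by right.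
  exists (a, b, i, j); last by rewrite xE yE.
  by rewrite mem_hookCJ -!mem_symbol_pos -!rholes_symbol_pos -xE -yE Xx Xy.
- rewrite map_inj_in_uniq.
    apply: (@hookCJ_uniq _ _ (msize mu)); rewrite /is_mpart eqxx andbT.
    exact/forallP.
  move=> [[[a b] i] j] [[[a' b'] i'] j'] _ _ [].
  by move=> /symbol_pos_inj[-> ->] /symbol_pos_inj[-> ->].
exact: hooks_uniq.
Qed.

Lemma sum_rholes_symbol N (h : nat -> nat) : h 0 = 0 -> L <= N ->
  \sum_(x < l * N | X x) h (rholes l X x) = \sum_(p <- mbar mu) h p.
Proof.
move=> h0 LN; rewrite (big_classes_cond _ l N X (fun x => h (rholes l X x))).
rewrite big_mbar /=.
apply: eq_bigr => j _; under eq_bigr do rewrite rholesE // holes_runner.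
rewrite -(sum_holes_beta (m := c j)) //; last exact: leq_trans (lam j) (cM j).
rewrite (eq_bigl (fun n : 'I_N => val n \in beta (c j) (mu j))) => [|n]; last exact: XE.
rewrite (big_window _ N (fun n => h (holes (mem (beta (c j) (mu j))) n))) ?beta_uniq //.
rewrite [LHS]big_seq_cond [RHS]big_seq; apply: eq_bigl => n.
case: (boolP (n \in _)) => //= nA.
have : runner l X j n by rewrite XE.
by move=> /(runner_lt (ltn_ord j) XL) nL; rewrite (leq_trans nL LN).
Qed.

Lemma overlap_symbol N : L <= N ->
  overlap l X (l * N) = 2 * Npart (mbar mu) + msize mu.
Proof.
move=> LN; rewrite Npart_mbar /overlap.
rewrite (eq_bigr (fun x : 'I__ => \sum_(p <- mbar mu) minn (rholes l X x) p));
  last by move=> x _; exact: (sum_rholes_symbol (minn0 _) LN).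
rewrite (sum_rholes_symbol (h := fun g => \sum_(p <- mbar mu) minn g p)) //.
by rewrite big1 // => p _; rewrite min0n.
Qed.

Lemma msize_symbol N : L <= N -> \sum_(x < l * N | X x) rholes l X x = msize mu.
Proof.
move=> LN; rewrite (sum_rholes_symbol (h := id)) // big_mbar.
by apply: eq_bigr => j _; rewrite sumnE.
Qed.
End SymbolHooks.

(** * The abacus of a partition and of its core *)

Lemma esymbol_sorted e la (j : 'I_e) : sorted ltn (esymbol la j).
Proof. exact/(sorted_filter ltn_trans)/iota_ltn_sorted. Qed.

Lemma mem_esymbol e la (j : 'I_e) k : (k \in esymbol la j) = (j + k * e \in Xset la).
Proof.
rewrite mem_filter mem_iota /= add0n andb_idr // => kX.
have : j + k * e <= \max_(x <- Xset la) x by apply: (leq_bigmax_seq (F := id)).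
by case: e j kX => [[]//|e] j kX; rewrite ltnS; nia.
Qed.

(** The beta-set of which ecore is the partition. *)
Definition core_beads e la :=
  sort leq [seq j + k * e | j : 'I_e <- enum 'I_e, k <- iota 0 (echarge la j)].

Lemma ord_gt0 n (i : 'I_n) : 0 < n.
Proof. exact: leq_ltn_trans (leq0n i) (ltn_ord i). Qed.

Lemma mem_core_beads e la (j : 'I_e) k :
  (j + k * e \in core_beads e la) = (k < echarge la j).
Proof.
rewrite mem_sort; apply/allpairsPdep/idP => [[j' [k' [_ +]]]|kj]; last first.
  by exists j, k; rewrite mem_enum mem_iota.
rewrite mem_iota => kj' E.
have jE : j = j' :> nat.
  by move/(congr1 (modn^~ e)): E; rewrite !(addnC (nat_of_ord _)) !modnMDl !modn_small.
move: E; rewrite -(val_inj jE) => /addnI/eqP; rewrite eqn_mul2r => /orP[e0|/eqP->].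
  by have := gtn_eqF (ord_gt0 j); rewrite e0.
by rewrite (val_inj jE).
Qed.

Lemma core_beads_sorted e la : sorted ltn (core_beads e la).
Proof.
rewrite ltn_sorted_uniq_leq sort_uniq sort_sorted ?andbT; last exact: leq_total.
apply: allpairs_uniq_dep; first exact: enum_uniq.
  by move=> j _; exact: iota_uniq.
move=> [i a] [j b] _ _ /= E.
have ij : i = j.
  apply: val_inj; move/(congr1 (modn^~ e)): E.
  by rewrite !(addnC (nat_of_ord _)) !modnMDl !modn_small.
move: E; rewrite ij => /addnI/eqP; rewrite eqn_mul2r => /orP[e0|/eqP-> //].
by have := gtn_eqF (ord_gt0 j); rewrite e0.
Qed.

Lemma ecore_part e la : is_part (ecore e la).
Proof. exact/Lambda_part/core_beads_sorted. Qed.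

Lemma equotient_part e la j : is_part (equotient e la j).
Proof. rewrite ffunE; exact/Lambda_part/esymbol_sorted. Qed.

Lemma beads_beta m la L : is_part la -> (forall x, x \in beta m la -> x < L) ->
  beads (mem (beta m la)) L = m.
Proof.
move=> pla mL; rewrite beads_mem ?beta_uniq // big_seq_cond.
rewrite (eq_bigl (mem (beta m la))) => [|x].
  by rewrite -big_seq sum1_size size_beta.
by rewrite andb_idr // => /mL.
Qed.

Section CoreQuotient.
Variables (e : nat) (la : seq nat).
Hypotheses (he : 0 < e) (hla : is_part la).

(** The number of beads added at the bottom of every runner: enough for all runners
    to reach the common size used by the formula for the quotient, and positive,
    since part_rank exceeds the number of parts by one. *)
Definition pad := (mrank (equotient e la)).+1.
Definition part_beads := beta (part_rank la + e * pad) la.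
Definition ecore_beads := beta (size (core_beads e la) + e * pad) (ecore e la).

Lemma runner_part_beads (j : 'I_e) n :
  runner e (mem part_beads) j n
  = (n \in beta (echarge la j + pad) (equotient e la j)).
Proof.
rewrite ffunE mem_beta_Lambda_shift ?esymbol_sorted // mem_esymbol.
rewrite /runner /= mem_beta_shift; last by rewrite size_part_rank.
have je := ltn_ord j.
case: (ltnP _ (e * pad)) => jn; case: (ltnP n pad) => nc //=; try nia.
by rewrite /Xset (_ : j + e * n - e * pad = j + (n - pad) * e) //; nia.
Qed.

Lemma runner_ecore_beads (j : 'I_e) n :
  runner e (mem ecore_beads) j n = (n < echarge la j + pad).
Proof.
rewrite /runner /= mem_beta_Lambda_shift ?core_beads_sorted //.
have je := ltn_ord j; case: (ltnP _ (e * pad)) => jn /=;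
  first by rewrite ltn_addl //; nia.
have pn : pad <= n by nia.
rewrite (_ : _ - _ = j + (n - pad) * e); last by nia.
by rewrite mem_core_beads ltn_subLR // addnC.
Qed.

Definition runner_len :=
  (\max_(x <- part_beads) x).+1 + pad + \sum_(j < e) echarge la j.

Lemma part_beads_lt x : x \in part_beads -> x < e * runner_len.
Proof.
move=> xX; have : x <= \max_(x <- part_beads) x by apply: (leq_bigmax_seq (F := id)).
by rewrite /runner_len; nia.
Qed.

Lemma residue x : exists (j : 'I_e) n, x = j + e * n.
Proof.
exists (Ordinal (ltn_pmod x he)), (x %/ e).
by rewrite {1}(divn_eq x e) addnC mulnC.
Qed.

Lemma is_core_ecore : is_core e runner_len (mem ecore_beads) (mem part_beads).
Proof.
have sh (j : 'I_e) : echarge la j + pad < runner_len.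
  by rewrite /runner_len (bigD1 j) //=; lia.
split=> [x|x|i ie|x].
- exact: part_beads_lt.
- have [j [n ->]] := residue x; rewrite -[mem _ _]/(runner e (mem ecore_beads) j n).
  by rewrite runner_ecore_beads => nj; have := sh j; have := ltn_ord j; nia.
- pose j := Ordinal ie.
  transitivity (echarge la j + pad).
    rewrite -[RHS]card_ord -sum1_card.
    rewrite (big_ord_widen runner_len (fun _ => 1) (ltnW (sh j))) [RHS]big_mkcond.
    by apply: eq_bigr => n _; rewrite (runner_ecore_beads j); case: ltnP.
  rewrite /beads; under [RHS]eq_bigr do rewrite (runner_part_beads j).
  apply/esym/beads_beta; first exact: equotient_part.
  by move=> x; rewrite -runner_part_beads; apply: runner_lt part_beads_lt x.
have [j [n ->]] := residue x; rewrite -[mem _ _]/(runner e (mem ecore_beads) j n).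
rewrite rholesE // runner_ecore_beads => nj.
rewrite /holes big1 // => k _; rewrite runner_ecore_beads.
by rewrite (ltn_trans _ nj).
Qed.

End CoreQuotient.

Section OnePartition.
Variables (nu : seq nat) (c L : nat).
Hypotheses (pnu : is_part nu) (cM : part_rank nu <= c).
Hypothesis cL : forall x, x \in beta c nu -> x < L.

Let pnu1 j : is_part (part1 nu j). Proof. by rewrite ffunE. Qed.

Let cM1 (j : 'I_1) : mrank (part1 nu) <= c.
Proof. by apply/bigmax_leqP => i _; rewrite ffunE. Qed.

Let runner1 (j : 'I_1) n : runner 1 (mem (beta c nu)) j n = (n \in beta c (part1 nu j)).
Proof. by rewrite ffunE ord1 /runner /= add0n mul1n. Qed.

Let cL1 x : mem (beta c nu) x -> x < 1 * L.
Proof. by rewrite mul1n; apply: cL. Qed.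

Lemma overlap_part1 W : L <= W ->
  overlap 1 (mem (beta c nu)) W = 2 * Npart (mbar (part1 nu)) + msize (part1 nu).
Proof. by move=> LW; rewrite -(overlap_symbol pnu1 cM1 runner1 cL1 LW) mul1n. Qed.

Lemma msize_part1 W : L <= W ->
  \sum_(x < W | (mem (beta c nu) : pred nat) x) rholes 1 (mem (beta c nu)) x
  = msize (part1 nu).
Proof. by move=> LW; rewrite -(msize_symbol pnu1 cM1 runner1 cL1 LW) mul1n. Qed.

Lemma perm_part1 W : 2 * L <= W ->
  perm_eq [seq symbol_hook (part1 nu) (fun _ => c) h | h <- hookCJ (part1 nu)]
    (hooks 1 (mem (beta c nu)) W).
Proof.
by move=> LW; apply: (perm_symbol_hooks pnu1 cM1 runner1 cL1); rewrite mul1n.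
Qed.
End OnePartition.

Lemma part_beads_rank e la : part_rank la <= part_rank la + e * pad e la.
Proof. exact: leq_addr. Qed.

Lemma ecore_beads_rank e la : 0 < e ->
  part_rank (ecore e la) <= size (core_beads e la) + e * pad e la.
Proof.
move=> he; rewrite size_part_rank ?ecore_part // -addn1 leq_add ?size_Lambda //.
by rewrite muln_gt0 he.
Qed.

(** The overlap is 2 N + n for each of the three multipartitions, and the sizes n are
    related by n(la) = n(core) + e n(quotient). *)
Lemma Npart_core e la : 0 < e -> is_part la ->
  Npart (mbar (part1 la)) = Npart (mbar (part1 (ecore e la)))
    + e * Npart (mbar (equotient e la))
    + descent e (mem (part_beads e la)) (e * (2 * runner_len e la)).
Proof.
move=> he hla; have CX := is_core_ecore he hla; have [XL CL _ _] := CX.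
have hN : runner_len e la <= 2 * runner_len e la by rewrite leq_pmull.
have cq (j : 'I_e) : mrank (equotient e la) <= echarge la j + pad e la.
  by rewrite /pad; lia.
have LW : e * runner_len e la <= e * (2 * runner_len e la) by rewrite leq_mul2l hN orbT.
have := overlap_core CX (leqnn _); have := size_core CX (leqnn _).
rewrite (overlap_symbol (equotient_part la) cq (runner_part_beads he hla) XL hN).
rewrite (msize_symbol (equotient_part la) cq (runner_part_beads he hla) XL hN).
rewrite (overlap_part1 hla (part_beads_rank _ _) XL LW).
rewrite (overlap_part1 (ecore_part e la) (ecore_beads_rank la he) CL LW).
rewrite (msize_part1 hla (part_beads_rank _ _) XL LW).
rewrite (msize_part1 (ecore_part e la) (ecore_beads_rank la he) CL LW).
lia.
Qed.

(** * The explicit formula and its specialisation *)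

Local Open Scope ring_scope.

Section LaurentFormula.
Variable l : nat.

Definition lQV (j : 'I_l) : laurent l := mklaurent 1 U_(lift ord0 j)%MM.

Lemma lQVK j : lQ j * lQV j = 1.
Proof.
apply: val_inj; rewrite /= lfracM /lfrac mulr1 add0m divff ?rmorph1 //.
exact: tofracX_neq0.
Qed.

(** The explicit formula lives in the fraction field, where the specialisation is
    not defined; this is the same element in the Laurent polynomial ring. *)
Definition CJ_laurent (mu : mpart l) : laurent l :=
  (-1) ^+ (msize mu * (l - 1)) * lqV l ^+ Npart (mbar mu) *
  \prod_(h <- hookCJ mu)
    (lq l ^+ h.1.1.1 * lqV l ^+ h.1.1.2 * lQ h.1.2 * lQV h.2 - 1).

Lemma rmorph_CJ (K : fieldType) (f : {rmorphism laurent l -> K}) mu :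
  f (CJ_laurent mu) =
  (-1) ^+ (msize mu * (l - 1)) * f (lq l) ^- Npart (mbar mu) *
  \prod_(h <- hookCJ mu)
    (f (lq l) ^ (h.1.1.1%:Z - h.1.1.2%:Z) * f (lQ h.1.2) / f (lQ h.2) - 1).
Proof.
have fV x y : x * y = 1 -> f y = (f x)^-1.
  move=> xy; have fxy : f x * f y = 1 by rewrite -rmorphM xy rmorph1.
  have fx0 : f x != 0 by apply: contra_eq_neq fxy => ->; rewrite mul0r eq_sym oner_eq0.
  by apply: (mulfI fx0); rewrite fxy divff.
have q0 : f (lq l) != 0.
  have : f (lq l) * f (lqV l) = 1 by rewrite -rmorphM lqVK rmorph1.
  by apply: contra_eq_neq => ->; rewrite mul0r eq_sym oner_eq0.
rewrite !rmorphM rmorphXn rmorphN1 rmorphXn (fV _ _ (lqVK l)) exprVn rmorph_prod.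
congr (_ * _); apply: eq_bigr => h _.
rewrite rmorphB rmorph1 !rmorphM !rmorphXn (fV _ _ (lqVK l)) (fV _ _ (lQVK _)).
by rewrite expfzDr // exprVn -exprnN.
Qed.

Lemma val_CJ mu : val (CJ_laurent mu) = CJ_formula mu.
Proof. exact: (rmorph_CJ val). Qed.
End LaurentFormula.

(** For d > 0, q^(-d) - 1 = - q^(-d) (q^d - 1). *)
Lemma prod_signed_hooks (K : fieldType) (Q : K) (s : seq (nat * nat)) : Q != 0 ->
  \prod_(h <- s) (Q ^ (h.1%:Z - h.2%:Z) - 1)
  = (-1) ^+ count (fun h => h.1 < h.2)%N s * Q ^- (\sum_(h <- s) (h.2 - h.1))%N
    * \prod_(h <- s) (Q ^+ hook_len h.1 h.2 - 1).
Proof.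
move=> Q0; elim: s => [|[x y] s IH] /=.
  by rewrite !big_nil expr0 invr1 !mulr1.
rewrite !big_cons IH /= /hook_len; case: (ltnP x y) => xy.
  have -> : (x - y + (y - x) = y - x)%N by lia.
  have -> : (x%:Z - y%:Z = - (y - x)%N%:Z)%R by lia.
  rewrite -exprnN !exprD expr1; set d := (y - x)%N.
  have Qd : Q ^+ d != 0 by rewrite expf_neq0.
  have Qs : Q ^+ (\sum_(j <- s) (j.2 - j.1))%N != 0 by rewrite expf_neq0.
  by field; rewrite Qd Qs.
have -> : (y - x = 0)%N by lia.
rewrite addn0 !add0n -[x%:Z - y%:Z](_ : (x - y)%N%:Z = _); last by lia.
by rewrite -exprnP; ring.
Qed.

Lemma CJ_formula1 nu c L W : is_part nu -> (part_rank nu <= c)%N ->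
  (forall x, x \in beta c nu -> x < L)%N -> (2 * L <= W)%N ->
  let Q := val (lq 1) in
  CJ_formula (part1 nu) = Q ^- Npart (mbar (part1 nu))
    * \prod_(d <- [seq hook_len h.1 h.2 | h <- hooks 1 (mem (beta c nu)) W])
        (Q ^+ d - 1).
Proof.
move=> pnu cM cL LW Q.
have Q0 : Q != 0 by rewrite /Q /= /lfrac mpolyX0 tofrac1 divr1 tofracX_neq0.
rewrite /CJ_formula subnn muln0 expr0 mul1r; congr (_ * _).
transitivity (\prod_(h <- hooks 1 (mem (beta c nu)) W) (Q ^ (h.1%:Z - h.2%:Z) - 1)).
  rewrite -(perm_big _ (perm_part1 pnu cM cL LW)) big_map.
  apply: eq_bigr => -[[[a b] i] j] _ /=; rewrite !ord1 mulfK; last first.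
    by rewrite /lfrac mpolyX0 tofrac1 divr1 tofracX_neq0.
  by congr (_ ^ _ - 1); rewrite /symbol_pos; lia.
rewrite prod_signed_hooks // big_map.
have -> : count (fun h => h.1 < h.2)%N (hooks 1 (mem (beta c nu)) W) = 0%N.
  apply/eqP; rewrite -leqn0 leqNgt -has_count; apply/hasP => -[[x y]].
  by rewrite mem_hooks hook1E /= => /and3P[/and3P[_ _ yx] _ _]; lia.
have := descent1 (mem (beta c nu)) W; rewrite /descent => ->.
by rewrite expr0 invr1 !mul1r.
Qed.

(** With these values on q and on the Q_j, a morphism sends the factor of a
    quadruple (a, b, i, j) to Q^(x - y) - 1, where x and y are the positions of
    the corresponding bead and hole. *)
Lemma rmorph_CJ_quotient (K : fieldType) (Q : K) e la
    (f : {rmorphism laurent e -> K}) :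
  (0 < e)%N -> is_part la -> Q != 0 -> f (lq e) = Q ^+ e ->
  (forall j, f (lQ j) = Q ^+ (e * echarge la j + j)) ->
  let W := (e * (2 * runner_len e la))%N in
  let X := mem (part_beads e la) in
  exists k, f (CJ_laurent (equotient e la))
    = (-1) ^+ k * Q ^- (e * Npart (mbar (equotient e la)) + descent e X W)
      * \prod_(d <- [seq hook_len h.1 h.2 | h <- hooks e X W]) (Q ^+ d - 1).
Proof.
move=> he hla Q0 fq fQ W X; have [XL _ _ _] := is_core_ecore he hla.
have cq (j : 'I_e) : (mrank (equotient e la) <= echarge la j + pad e la)%N.
  by rewrite /pad; lia.
have W2 : (2 * (e * runner_len e la) <= W)%N by rewrite mulnCA.
exists (msize (equotient e la) * (e - 1)
        + count (fun h => h.1 < h.2) (hooks e X W))%N.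
rewrite rmorph_CJ exprD [in RHS]exprD invfM -!mulrA; congr (_ * _).
rewrite fq -exprM [RHS]mulrCA; congr (_ * _).
rewrite big_map mulrA -prod_signed_hooks //.
have perm := perm_symbol_hooks (equotient_part la) cq (runner_part_beads he hla) XL W2.
rewrite -(perm_big _ perm).
rewrite big_map; apply: eq_bigr => -[[[a b] i] j] _ /=.
rewrite !fQ [Q ^+ e]exprnP exprz_exp -mulrA exprnN [X in _ * (X * _)]exprnP.
rewrite -!expfzDr //; congr (_ ^ _ - 1).
by rewrite /symbol_pos; have := cq i; have := cq j; nia.
Qed.

Theorem theorem3p3p1
    (* the Schur elements of the generic Ariki-Koike algebras, for the labelling
       of characters in which the known explicit formula holds *)
    (s : forall l : nat, mpart l -> laurent l)
    (hs : forall l m : nat, (0 < l)%N -> schur_elements m (s l))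
    (hlabel : forall (l m : nat) (mu : mpart l), (0 < l)%N -> is_mpart m mu ->
       val (stilde (s l) mu) = CJ_formula mu)
    (e n : nat) (he : (0 < e)%N) (hn : (0 < n)%N)
    (la : seq nat) (hla : is_part la) (hsize : sumn la = n) :
  let st_la := stilde (s 1%N) (part1 la) in
  let st_core := stilde (s 1%N) (part1 (ecore e la)) in
  let st_quo := stilde (s e) (equotient e la) in
  let t := fun j : 'I_e => (e * echarge la j + j)%N in
  (* an identity in the fraction field of Z[q^{+-1}, Q_1^{+-1}] *)
  val st_la = val st_core * qincl 1 (theta e t st_quo) \/
  val st_la = - (val st_core * qincl 1 (theta e t st_quo)).
Proof.
move=> st_la st_core st_quo t.
have mpartE l (mu : mpart l) : (forall j, is_part (mu j)) -> is_mpart (msize mu) mu.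
  by move=> pmu; rewrite /is_mpart eqxx andbT; apply/forallP.
have part1E nu : is_part nu -> forall j, is_part (part1 nu j).
  by move=> pnu j; rewrite ffunE.
have core_p := ecore_part e la.
have -> : st_quo = CJ_laurent (equotient e la).
  by apply: val_inj; rewrite (hlabel _ _ _ he (mpartE _ _ (equotient_part la))) val_CJ.
rewrite (hlabel 1%N _ _ isT (mpartE _ _ (part1E _ hla))).
rewrite (hlabel 1%N _ _ isT (mpartE _ _ (part1E _ core_p))).
pose W := (e * (2 * runner_len e la))%N.
have CX := is_core_ecore he hla; have [XL CL _ _] := CX.
have W2 : (2 * (e * runner_len e la) <= W)%N by rewrite mulnCA.
rewrite (CJ_formula1 hla (part_beads_rank e la) XL W2).
rewrite (CJ_formula1 core_p (ecore_beads_rank la he) CL W2).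
rewrite (perm_big _ (perm_hooks CX W2)) big_cat /= (Npart_core he hla) -/W.
set Q := lfrac _ _.
have Q0 : Q != 0 by rewrite /Q /lfrac mpolyX0 tofrac1 divr1 tofracX_neq0.
pose f : {rmorphism laurent e -> ratfun 1} := qincl 1 \o theta e t.
have fq : f (lq e) = Q ^+ e by rewrite /f /= theta_q rmorphXn /= qincl_qq.
have fQ j : f (lQ j) = Q ^+ t j by rewrite /f /= theta_Q rmorphXn /= qincl_qq.
have [k] := rmorph_CJ_quotient he hla Q0 fq fQ.
rewrite -[f _]/(qincl 1 (theta e t _)) -/W => ->.
set N := Npart _; set N' := Npart _; set D := descent _ _ _.
rewrite -addnA exprD invfM -signr_odd.
case: odd; [right|left];
  by rewrite ?expr0 ?expr1 ?mulN1r ?mulNr ?mulrN ?opprK ?mul1r mulrACA.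
Qed.
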